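(* There exists a finitely generated, residually finite, infinite group $\Gamma$ with $\rho(\Gamma)=0$.
   Context: $r_n(\Gamma)$ is the number of isomorphism classes of $n$-dimensional irreducible complex representations of $\Gamma$, $R_n(\Gamma)=\sum_{i=1}^n r_i(\Gamma)$, and $\rho(\Gamma)=\limsup_{n\to\infty}\frac{\log R_n(\Gamma)}{\log n}\in[0,\infty]$; if $R_n(\Gamma)$ is not polynomially bounded (in particular if $R_n(\Gamma)$ is infinite for some $n$), $\rho(\Gamma)=\infty$. *)

(* Defs.v *)
From mathcomp Require Import all_boot all_order all_algebra all_fingroup.
From mathcomp Require Import all_classical all_reals all_analysis.
From mathcomp Require Import complex.

Set Implicit Arguments.
Unset Strict Implicit.
Unset Printing Implicit Defensive.

Import Order.TTheory GRing.Theory Num.Theory.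

Local Open Scope classical_set_scope.
Local Open Scope ring_scope.

Section Groups.
Variable G : groupType.

Definition is_subgroup (H : set G) : Prop :=
  [/\ H 1%g,
      forall x y, H x -> H y -> H (x * y)%g
    & forall x, H x -> H x^-1%g].

Definition finitely_generated : Prop :=
  exists S : set G, finite_set S /\ smallest is_subgroup S = [set: G].

Definition residually_finite : Prop :=
  forall x : G, x <> 1%g ->
    exists (Q : finGroupType) (f : {multiplicative G -> Q}), f x <> 1%g.

End Groups.

(* [mx_representation] of MathComp is restricted to finite groups; the
   definitions below are its analogues (with matrices acting on row vectors)
   for an arbitrary group. *)
Section Representations.
Variables (F : fieldType) (G : groupType) (n : nat).
Implicit Types r s : G -> 'M[F]_n.

Definition is_repr r : Prop :=
  r 1%g = 1%:M /\ {morph r : x y / (x * y)%g >-> x *m y}.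

Definition repr_irreducible r : Prop :=
  (0 < n)%N /\
  forall U : 'M[F]_n, (forall x, stablemx U (r x)) -> U != 0 -> row_full U.

Definition repr_iso r s : Prop :=
  exists2 P : 'M[F]_n, P \in unitmx & forall x, r x *m P = P *m s x.

Definition repr_iso_class r : set (G -> 'M[F]_n) :=
  [set s | is_repr s /\ repr_iso r s].

Definition irr_classes : set (set (G -> 'M[F]_n)) :=
  [set repr_iso_class r | r in [set r | is_repr r /\ repr_irreducible r]].

End Representations.

Arguments irr_classes : clear implicits.

Section RepresentationGrowth.
Variables (R : realType) (G : groupType).
Local Open Scope ereal_scope.

(* [counting] is the cardinality of a finite set and +oo for an infinite one. *)
Definition num_irr (n : nat) : \bar R := counting (irr_classes R[i] G n).

Definition num_irr_le (n : nat) : \bar R := \sum_(1 <= i < n.+1) num_irr i.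

(* As [lne +oo = +oo], the value is +oo whenever [num_irr_le n] is infinite for
   some n. The junk values of the quotient at n = 0, 1 do not affect the upper
   limit. *)
Definition repr_growth : \bar R :=
  limn_esup (fun n => lne (num_irr_le n) * ((ln n%:R)^-1)%:E).

End RepresentationGrowth.

(* Main.v *)
(* The group is a branch group acting on a rooted tree whose vertices of depth k
   have n_k children, where n_0, n_1, ... grows very fast. It is generated by the
   alternating group permuting the n_0 subtrees of the root and by three copies of
   A_5 acting along an infinite ray and next to it; commutators of these generate
   the analogous group of every subtree, so the group is an iterated wreath product
   of alternating groups in a strong sense. As an alternating group of large degree
   has no nontrivial representation of small degree, and as the normal closure of
   the alternating groups of a level contains everything below that level, a
   representation of degree N factors through the action on a finite level, which is
   an extension of a power of some A_n by a group that is tiny compared with n. By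
   Clifford theory it remains to count the irreducible representations of the power.

   For A_n, 3-cycles with a nontrivial eigenvalue come with two equidimensional
   eigenspaces, so every representation of degree at most N has a nonzero vector
   fixed by A_{n-t} with t = O(log N). The irreducible representations with such a
   vector are counted by the double cosets of A_{n-t} up to conjugation by A_t, as
   the functions g |-> tr (r g E), E the projection onto the fixed vectors, are
   linearly independent. Such classes are partial injections of t points up to
   conjugacy, hence pairs of partitions: there are exp (O (sqrt t * log t)) of them,
   and this is N^o(1). *)
From HB Require Import structures.
Require Import Defs.
From mathcomp Require Import all_boot all_order all_algebra all_fingroup all_solvable.
From mathcomp Require Import boolp.
From mathcomp Require Import ring zify.

Set Implicit Arguments.
Unset Strict Implicit.
Unset Printing Implicit Defensive.

Import Order.TTheory GRing.Theory Num.Theory.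

(** * Alternating groups *)

Local Open Scope group_scope.

(** Finite generation is the obstacle to letting the degrees grow: the alternating groups of
    different levels are different groups, so a directed generator cannot carry them. It carries
    [A_5] instead, which acts on every alphabet in three ways whose images together generate the
    alternating group; the alphabets are built for this. Perfection of [A_5] does the localizing,
    since it is then enough to place commutators in a single subtree.

    The bound has the form [m! * keys ^ m], with [m] the number of vertices of a level, and for
    every [a] it must stay below [N ^ (1/a)] once [N] is large. Hence [m] has to be fixed before [N]
    starts to range, and the next degree has to be enormous compared with every [N] for which the
    level is responsible.

    In the count no quotient group is formed: a coset decomposition modulo the common kernel of the
    given representations replaces the finite quotient, and independence of matrix coefficients,
    valid for any group, replaces orthogonality of characters. *)

Section Perms.
Variable T : finType.
Implicit Types (X Y Z : {set T}) (s t : {perm T}).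

Definition tri (x y z : T) : {perm T} := tperm x y * tperm x z.

Lemma triE x y z : uniq [:: x; y; z] ->
  [/\ tri x y z x = y, tri x y z y = z & tri x y z z = x].
Proof.
rewrite /= !inE negb_or !andbT => /andP[/andP[xy xz] yz].
rewrite /tri !permM; split.
- by rewrite tpermL tpermD // eq_sym.
- by rewrite tpermR tpermL.
- by rewrite (tpermD xz yz) tpermR.
Qed.

Lemma tri_out x y z w : w \notin [:: x; y; z] -> tri x y z w = w.
Proof.
rewrite !inE !negb_or => /and3P[wx wy wz].
by rewrite /tri permM !tpermD // eq_sym.
Qed.

Lemma triJ x y z s : tri x y z ^ s = tri (s x) (s y) (s z).
Proof. by rewrite conjMg !tpermJ. Qed.

Lemma tri_even x y z : uniq [:: x; y; z] -> tri x y z = false :> bool.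
Proof.
rewrite /= !inE negb_or !andbT => /andP[/andP[xy xz] yz].
by rewrite odd_permM !odd_tperm xy xz.
Qed.

Lemma tri_on X x y z : x \in X -> y \in X -> z \in X -> perm_on X (tri x y z).
Proof.
move=> xX yX zX; apply/subsetP=> w; rewrite inE; apply: contraR => wX.
apply/eqP/tri_out; rewrite !inE !negb_or.
by apply/and3P; split; apply: contraNneq wX => ->.
Qed.

(** Each point [x] of [X] other than [a] and [b] can be split off: a product of the given 3-cycles
    brings [s x] back to [x], which leaves an even permutation of [X :\ x]. On two points only the
    identity is even. *)
Lemma alt_gen X (a b : T) (P : {perm T} -> Prop) : a \in X -> b \in X -> a != b ->
    P 1 -> (forall s t, P s -> P t -> P (s * t)) -> (forall s, P s -> P s^-1) ->
    (forall z, z \in X -> z != a -> z != b -> P (tri a b z)) ->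
  forall s, perm_on X s -> s = false :> bool -> P s.
Proof.
elim: {X}_.+1 {-2}X (ltnSn #|X|) => // n IH X.
rewrite ltnS => cX aX bX ab P1 PM PV Ptri s sX es.
have [Xab|/subsetPn[x xX]] := boolP (X \subset [set a; b]).
  have sab : perm_on [set a; b] s by apply: subset_trans Xab.
  suff -> : s = 1 by [].
  have [sa|sa] := eqVneq (s a) a.
    have sb : s b = b.
      have := perm_closed b sab; rewrite !inE eqxx orbT.
      by move=> /orP[]/eqP // e; move: ab; rewrite -(inj_eq (@perm_inj _ s)) e sa eqxx.
    apply/permP => w; rewrite perm1; have [->//|wa] := eqVneq w a.
    by have [->//|wb] := eqVneq w b; rewrite (out_perm sab) // !inE negb_or wa.
  have {}sa : s a = b.
    by have := perm_closed a sab; rewrite !inE eqxx (negPf sa) /= => /eqP.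
  have sb : s b = a.
    have := perm_closed b sab; rewrite !inE eqxx orbT => /orP[/eqP//|/eqP e].
    by move: ab; rewrite -(inj_eq (@perm_inj _ s)) e sa eqxx.
  have E : s = tperm a b.
    apply/permP => w; have [->|wa] := eqVneq w a; first by rewrite tpermL.
    have [->|wb] := eqVneq w b; first by rewrite tpermR.
    by rewrite (out_perm sab) ?tpermD // ?[_ == w]eq_sym // !inE negb_or wa.
  by move: es; rewrite E odd_tperm ab.
rewrite !inE negb_or => /andP[xa xb].
suff [w [Pw wX wx ew]] : exists w, [/\ P w, perm_on X w, w (s x) = x & w = false :> bool].
  rewrite -[s](mulgK w); apply: (PM); last exact: PV.
  have aX' : a \in X :\ x by rewrite !inE eq_sym xa.
  have bX' : b \in X :\ x by rewrite !inE eq_sym xb.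
  have cX' : #|X :\ x| < n by move: cX; rewrite (cardsD1 x) xX.
  apply: (IH _ cX' aX' bX' ab P1 PM PV).
  - by move=> z; rewrite !inE => /andP[zx zX] za zb; apply: Ptri.
  - apply/subsetP => z; rewrite !inE => zz; apply/andP; split.
      by apply: contraNneq zz => ->; rewrite permM wx.
    by apply: contraNT zz => zX; rewrite permM (out_perm sX) // (out_perm wX).
  by rewrite odd_permM es ew.
have ux : uniq [:: a; b; x] by rewrite /= !inE negb_or ab ![_ == x]eq_sym xa xb.
have [e1 e2 e3] := triE ux.
have Ptx : P (tri a b x) by apply: Ptri.
have [sx|sx] := eqVneq (s x) x; first by exists 1; rewrite perm1 odd_perm1 perm_on1.
have sxX : s x \in X by rewrite perm_closed.
have [sxb|sxb] := eqVneq (s x) b.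
  by exists (tri a b x); rewrite sxb e2 tri_on ?tri_even.
pose w2 := tri a b x * tri a b x.
have Pw2 : P w2 by apply: PM.
have ew2 : w2 = false :> bool by rewrite odd_permM addbb.
have ow2 : perm_on X w2 by apply: perm_onM; apply: tri_on.
have w2a : w2 a = x by rewrite permM e1 e2.
have [sxa|sxa] := eqVneq (s x) a; first by exists w2; rewrite sxa.
have uy : uniq [:: a; b; s x] by rewrite /= !inE negb_or ab ![_ == s x]eq_sym sxa sxb.
have [f1 f2 f3] := triE uy.
exists (tri a b (s x) * w2); split.
- by apply: PM => //; apply: Ptri.
- by apply: perm_onM => //; apply: tri_on.
- by rewrite permM f3.
- by rewrite odd_permM ew2 tri_even.
Qed.

(** Two 3-cycles whose supports meet in one point have a 3-cycle as commutator. This takes five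
    points, whence the degree in [alt_perfect]. *)
Lemma tri_commg a b z d e : uniq [:: a; b; z; d; e] ->
  tri a b z = [~ tri b a d, tri b z e].
Proof.
rewrite /= !inE !negb_or !andbT => /and4P[/and4P[ab az ad ae] /and3P[bz bd be] /andP[zd ze] de].
rewrite commgEl triJ; apply: (mulgI (tri b a d)); rewrite mulKVg.
have u1 : uniq [:: b; z; e] by rewrite /= !inE negb_or bz be ze.
have [-> _ _] := triE u1.
rewrite !tri_out ?inE ?negb_or; last 2 first.
- by rewrite eq_sym bd eq_sym zd de.
- by rewrite ab az ae.
apply/permP => w; rewrite /tri !permM.
have H x y : x != y -> (x == y = false) * (y == x = false).
  by move=> h; rewrite [y == x]eq_sym (negPf h).
rewrite !permE /=.
pose Hs := (eqxx, H _ _ _ ab, H _ _ _ az, H _ _ _ ad, H _ _ _ bz, H _ _ _ bd, H _ _ _ zd).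
case: (eqVneq w b) => [->|wb]; first by do !rewrite /= ?Hs.
case: (eqVneq w a) => [->|wa]; first by do !rewrite /= ?Hs.
case: (eqVneq w d) => [->|wd]; first by do !rewrite /= ?Hs.
case: (eqVneq w z) => [->|wz]; first by do !rewrite /= ?Hs.
by do !rewrite /= ?(negPf wb) ?(negPf wa) ?(negPf wd) ?(negPf wz).
Qed.

Lemma exists_notin (s : seq T) : size s < #|T| -> exists x, x \notin s.
Proof.
move=> h; apply/existsP; apply: contraLR h; rewrite negb_exists => /forallP h.
rewrite -leqNgt (leq_trans _ (card_size s)) // subset_leq_card //.
by apply/subsetP => x _; have := h x; rewrite negbK.
Qed.

Lemma tri_cube x y z : uniq [:: x; y; z] -> tri x y z * tri x y z * tri x y z = 1.
Proof.
move=> u; have [e1 e2 e3] := triE u; have tout := @tri_out x y z.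
move: (tri x y z) e1 e2 e3 tout => t e1 e2 e3 tout.
apply/permP => w; rewrite !permM perm1.
have [|wn] := boolP (w \in [:: x; y; z]); last by rewrite !(tout _ wn).
by rewrite !inE => /or3P[]/eqP ->; rewrite ?(e1, e2, e3).
Qed.

Lemma even_trans x y : 2 < #|T| ->
  exists2 p : {perm T}, p = false :> bool & p x = y.
Proof.
move=> T3; have [->|xy] := eqVneq x y; first by exists 1; rewrite ?odd_perm1 ?perm1.
have [z] : exists z, z \notin [:: x; y] by apply: exists_notin.
rewrite !inE negb_or => /andP[zx zy].
have u : uniq [:: x; y; z] by rewrite /= !inE negb_or xy ![_ == z]eq_sym zx zy.
by exists (tri x y z); [apply: tri_even | have [] := triE u].
Qed.

(** Perfection as an induction principle. In the branch group only commutators can be confined to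
    one subtree, and this extends the result to all even permutations. *)
Lemma alt_perfect (P : {perm T} -> Prop) : 4 < #|T| ->
    P 1 -> (forall s t, P s -> P t -> P (s * t)) -> (forall s, P s -> P s^-1) ->
    (forall s t, s = false :> bool -> t = false :> bool -> P [~ s, t]) ->
  forall s, s = false :> bool -> P s.
Proof.
move=> cT P1 PM PV PR s es.
have [a _] : exists a, a \notin ([::] : seq T) by apply: exists_notin; apply: leq_trans cT.
have [b] : exists b, b \notin [:: a] by apply: exists_notin; apply: leq_trans cT.
rewrite inE => ba.
apply: (@alt_gen setT a b); rewrite ?inE 1?eq_sym //; last first.
  by apply/subsetP => x; rewrite inE.
move=> z _ za zb.
have [d dn] : exists d, d \notin [:: a; b; z] by apply: exists_notin; apply: leq_trans cT.
have [e en] : exists e, e \notin [:: a; b; z; d] by apply: exists_notin; apply: leq_trans cT.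
have u : uniq [:: a; b; z; d; e].
  rewrite -(rev_uniq) /= !inE !negb_or ba za zb.
  by move: dn en; rewrite !inE !negb_or => /and3P[-> -> ->] /and4P[-> -> -> ->].
rewrite (tri_commg u); apply: PR; apply: tri_even;
by move: u; rewrite /= !inE !negb_or !andbT => /and4P[/and4P[ab az ad ae] /and3P[bz bd be] /andP[zd ze] de];
   rewrite ?ba ?bd ?ad ?bz ?be ?ze.
Qed.

End Perms.

(** * Diagonal action of a symmetric group on a family of disjoint blocks *)

Section BlockAction.
Variables (Q I X : finType) (e : Q * I -> X).
Hypothesis e_inj : injective e.

Definition block_fun (p : {perm I}) (x : X) : X :=
  if [pick u | e u == x] is Some u then e (u.1, p u.2) else x.

Lemma block_funE p u : block_fun p (e u) = e (u.1, p u.2).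
Proof.
by rewrite /block_fun; case: pickP => [v /eqP/e_inj -> //|/(_ u)]; rewrite eqxx.
Qed.

Lemma block_fun_out p x : (forall u, e u != x) -> block_fun p x = x.
Proof. by move=> h; rewrite /block_fun; case: pickP => // u; rewrite (negPf (h u)). Qed.

Variant block_spec (x : X) : Prop :=
  | BlockIn u of x = e u
  | BlockOut of (forall u, e u != x).

Lemma blockP x : block_spec x.
Proof.
have [u /eqP <-|h] := pickP (fun u => e u == x); first exact: (BlockIn (u := u)).
by apply: BlockOut => u; rewrite h.
Qed.

Lemma block_fun_inj p : injective (block_fun p).
Proof.
move=> x y; have [[q i] ->|hx] := blockP x; have [[r j] ->|hy] := blockP y.
- by rewrite !block_funE => /e_inj[-> /perm_inj ->].
- by rewrite block_funE (block_fun_out _ hy) => h; move: (hy (q, p i)); rewrite h eqxx.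
- by rewrite block_funE (block_fun_out _ hx) => h; move: (hx (r, p j)); rewrite h eqxx.
- by rewrite !block_fun_out.
Qed.

Definition block p : {perm X} := perm (@block_fun_inj p).

Lemma blockE p q i : block p (e (q, i)) = e (q, p i).
Proof. by rewrite permE block_funE. Qed.

Lemma block_out p x : (forall u, e u != x) -> block p x = x.
Proof. by move=> h; rewrite permE block_fun_out. Qed.

Lemma blockM p q : block (p * q) = block p * block q.
Proof.
apply/permP => x; rewrite permM; have [[r i] ->|h] := blockP x; first by rewrite !blockE permM.
by rewrite !block_out.
Qed.

Lemma block1 : block 1 = 1.
Proof.
apply/permP => x; rewrite perm1; have [[r i] ->|h] := blockP x; first by rewrite blockE perm1.
by rewrite block_out.
Qed.

Lemma blockV p : block p^-1 = (block p)^-1.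
Proof. by apply: (mulgI (block p)); rewrite -blockM !mulgV block1. Qed.

(** A 3-cycle is the square of its own square, so its image under the homomorphism [block] is a
    square, hence even whatever the number of blocks. *)
Lemma block_even (p : {perm I}) : 1 < #|I| -> p = false :> bool -> block p = false :> bool.
Proof.
move=> cI; have [a _] : exists a, a \notin ([::] : seq I).
  by apply: exists_notin; apply: ltn_trans cI.
have [b] : exists b, b \notin [:: a] by apply: exists_notin.
rewrite inE => ba.
move=> ep; have pT : perm_on setT p by apply/subsetP => x; rewrite inE.
move: p pT ep.
apply: (@alt_gen I setT a b (fun p => block p = false :> bool)); rewrite ?inE 1?eq_sym //.
- by rewrite block1 odd_perm1.
- by move=> s t; rewrite blockM odd_permM => -> ->.
- by move=> s; rewrite blockV odd_permV.
- move=> z _ za zb; have u : uniq [:: a; b; z].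
    by rewrite /= !inE negb_or eq_sym ba ![_ == z]eq_sym za zb.
  have [e1 e2 e3] := triE u.
  suff -> : tri a b z = (tri a b z * tri a b z) * (tri a b z * tri a b z).
    by rewrite blockM odd_permM addbb.
  have tout := @tri_out _ a b z; move: (tri a b z) e1 e2 e3 tout => t e1 e2 e3 tout.
  apply/permP => w; rewrite !permM.
  have [|wn] := boolP (w \in [:: a; b; z]); last by rewrite !(tout _ wn).
  by rewrite !inE => /or3P[]/eqP ->; rewrite ?(e1, e2, e3).
Qed.

End BlockAction.

(** A row of 8 cells is one period of a chain of 5-point blocks in which consecutive blocks share a
    point. Of the two extra points, [pt0] continues the ray of the directed generators and [pt1] is
    the vertex next to it. *)
Definition alphabet (J : nat) : finType := option (option ('I_J.+1 * 'I_8)).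

Section Alphabet.
Variable J : nat.
Local Notation X := (alphabet J).

Definition pt0 : X := None.
Definition pt1 : X := Some None.
Definition cell (q r : nat) : X := Some (Some (inord q, inord r)).

Definition emb0 (u : 'I_J.+1 * 'I_5) : X := Some (Some (u.1, widen_ord (isT : 5 <= 8) u.2)).
(* The last point of each block is the first point of a block of [emb0], so
   the blocks of [emb0] and [emb1] form a closed chain. *)
Definition emb1 (u : 'I_J.+1 * 'I_5) : X :=
  if (u.2 < 4) then cell u.1 (u.2 + 4) else cell (u.1.+1 %% J.+1) 0.
(** A single block tying [pt0] and [pt1], which [emb0] and [emb1] avoid, to the start of the
    chain. *)
Definition emb2 (u : unit * 'I_5) : X :=
  if u.2 == 0 :> nat then pt0 else if u.2 == 1%N :> nat then pt1 else cell 0 (u.2 - 2).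

Lemma cell_inj q r q' r' : q < J.+1 -> q' < J.+1 -> r < 8 -> r' < 8 ->
  cell q r = cell q' r' -> q = q' /\ r = r'.
Proof.
move=> hq hq' hr hr' [/(congr1 val) /= e1 /(congr1 val) /= e2].
by move: e1 e2; rewrite !inordK.
Qed.

Lemma emb0_inj : injective emb0.
Proof. by move=> [q i] [q' i'] [-> /= e]; congr (_, _); apply: val_inj. Qed.

Lemma emb1_inj : injective emb1.
Proof.
move=> [q i] [q' i']; rewrite /emb1 /=.
have hi := ltn_ord i; have hi' := ltn_ord i'; have hq := ltn_ord q; have hq' := ltn_ord q'.
have M x : x %% J.+1 < J.+1 by rewrite ltn_pmod.
have S (x : 'I_J.+1) : x.+1 %% J.+1 = if x.+1 == J.+1 then 0 else x.+1.
  have := ltn_ord x; case: eqP => [-> _|h1 h2]; first by rewrite modnn.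
  by rewrite modn_small //; lia.
case: ltnP => h; case: ltnP => h' /cell_inj[||||e1 e2] //; try lia.
  by congr (_, _); apply: val_inj => /=; lia.
congr (_, _); apply: val_inj => /=; last lia.
by move: e1; rewrite !S; case: eqP; case: eqP; lia.
Qed.

Lemma emb2_inj : injective emb2.
Proof.
move=> [[] i] [[] i'] h; congr (_, _); apply: val_inj; move: h; rewrite /emb2 /=.
have hi := ltn_ord i; have hi' := ltn_ord i'.
case: eqP => [->|h1]; case: eqP => [->|h1'] //; case: eqP => [->|h2] //;
  case: eqP => [->|h2'] // /cell_inj[||||_]; lia.
Qed.

Definition blk (l : 'I_3) (p : {perm 'I_5}) : {perm X} :=
  if l == 0 :> nat then block emb0_inj p
  else if l == 1%N :> nat then block emb1_inj p else block emb2_inj p.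

Lemma blkM l : {morph blk l : p q / p * q}.
Proof. by move=> p q; rewrite /blk; do 2?case: ifP => _; rewrite blockM. Qed.

Lemma blk1 l : blk l 1 = 1.
Proof. by rewrite /blk; do 2?case: ifP => _; rewrite block1. Qed.

Lemma blkV l p : blk l p^-1 = (blk l p)^-1.
Proof. by apply: (mulgI (blk l p)); rewrite -blkM !mulgV blk1. Qed.

Lemma blk_even l (p : {perm 'I_5}) : p = false :> bool -> blk l p = false :> bool.
Proof. by move=> h; rewrite /blk; do 2?case: ifP => _; rewrite block_even ?card_ord. Qed.

(** The block of [emb2] supplies the 3-cycle on [pt0], [pt1] and the first cell. The other two
    actions fix [pt0] and [pt1], so conjugation by them moves only the third point, along the chain
    and thus to every cell; [alt_gen] concludes. *)
Lemma blk_gen (P : {perm X} -> Prop) :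
    P 1 -> (forall s t, P s -> P t -> P (s * t)) -> (forall s, P s -> P s^-1) ->
    (forall l (p : {perm 'I_5}), p = false :> bool -> P (blk l p)) ->
  forall s : {perm X}, s = false :> bool -> P s.
Proof.
move=> P1 PM PV Pblk s es.
have PJ t u : P t -> P u -> P (t ^ u).
  by move=> Pt Pu; rewrite conjgE; apply: (PM); [exact: PV | exact: PM].
pose l0 := @Ordinal 3 0 isT; pose l1 := @Ordinal 3 1 isT; pose l2 := @Ordinal 3 2 isT.
have five : 2 < #|'I_5| by rewrite card_ord.
pose A x := P (tri pt0 pt1 x).
have step0 q i j : A (emb0 (q, i)) -> A (emb0 (q, j)).
  have [p ep <-] := @even_trans _ i j five; move=> /PJ /(_ (Pblk l0 p ep)).
  by rewrite triJ /blk /= blockE !block_out.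
have step1 q i j : A (emb1 (q, i)) -> A (emb1 (q, j)).
  have [p ep <-] := @even_trans _ i j five; move=> /PJ /(_ (Pblk l1 p ep)).
  by rewrite triJ /blk /= blockE !block_out // => -[? ?]; rewrite /emb1; case: ifP.
have cell0 q (hq : q < J.+1) r (hr : r < 5) :
    cell q r = emb0 (Ordinal hq, Ordinal hr).
  congr (Some (Some (_, _))); apply: val_inj; rewrite /= inordK //.
  exact: leq_trans hr _.
have cell1 q (hq : q < J.+1) r (hr : r < 4) :
    cell q (r + 4) = emb1 (Ordinal hq, @Ordinal 5 r (ltnW hr)).
  by rewrite /emb1 /= hr.
have cell1' q (hq : q.+1 < J.+1) :
    cell q.+1 0 = emb1 (Ordinal (ltnW hq), @Ordinal 5 4 isT).
  by rewrite /emb1 /= modn_small.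
have Aq q (hq : q < J.+1) : A (cell q 0) -> forall r, r < 8 -> A (cell q r).
  move=> a0 r hr.
  have a5 r' (hr' : r' < 5) : A (cell q r').
    by rewrite (cell0 _ hq _ hr') (cell0 _ hq 0 isT) in a0 *; apply: step0 a0.
  have [/a5 //|h5] := ltnP r 5.
  have h4 : r - 4 < 4 by lia.
  rewrite (_ : r = r - 4 + 4); last lia.
  by have := a5 (0 + 4)%N isT; rewrite (cell1 _ hq 0 isT) (cell1 _ hq _ h4); apply: step1.
have A0 : A (cell 0 0).
  pose t := @tri 'I_5 (@Ordinal 5 0 isT) (@Ordinal 5 1 isT) (@Ordinal 5 2 isT).
  have et : t = false :> bool by apply: tri_even.
  have := Pblk l2 t et; rewrite /blk /=.
  have [//|e1 e2 e3] := @triE _ (@Ordinal 5 0 isT) (@Ordinal 5 1 isT) (@Ordinal 5 2 isT).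
  congr (P _); apply/permP => x.
  have p0 : pt0 = emb2 (tt, @Ordinal 5 0 isT) by [].
  have p1 : pt1 = emb2 (tt, @Ordinal 5 1 isT) by [].
  have p2 : cell 0 0 = emb2 (tt, @Ordinal 5 2 isT) by [].
  rewrite -/t in e1 e2 e3.
  have [|xn] := boolP (x \in [:: pt0; pt1; cell 0 0]).
    have u : uniq [:: pt0; pt1; cell 0 0] by [].
    have [f1 f2 f3] := triE u.
    by rewrite !inE => /or3P[]/eqP ->; rewrite ?(f1, f2, f3) ?p0 ?p1 ?p2 blockE ?(e1, e2, e3).
  rewrite (tri_out xn); have [[[] i] xe|h] := blockP emb2 x; last by rewrite block_out.
  rewrite xe blockE /t tri_out //; apply: contra xn; rewrite !inE xe p0 p1 p2.
  by move=> /or3P[]/eqP ->; rewrite eqxx ?orbT.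
have Aall q : q < J.+1 -> A (cell q 0).
  elim: q => [//|q IH] hq.
  have := Aq q (ltnW hq) (IH (ltnW hq)) (0 + 4)%N isT.
  by rewrite (cell1' _ hq) (cell1 _ (ltnW hq) 0 isT); apply: step1.
have sT : perm_on setT s by apply/subsetP => x; rewrite inE.
move: s sT es; apply: (@alt_gen _ setT pt0 pt1); rewrite ?inE //.
move=> [[[q r]|]|] // _ _ _.
have -> : Some (Some (q, r)) = cell q r by rewrite /cell !inord_val.
by apply: Aq => //; apply: Aall.
Qed.

Lemma card_alphabet : #|X| = (8 * J.+1).+2.
Proof. by rewrite !card_option card_prod !card_ord mulnC. Qed.

End Alphabet.

(** * Double cosets of pointwise stabilizers in alternating groups *)

Section Extend.
Variable T : finType.
Implicit Types (A Z : {set T}).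

Lemma extend_perm A (f : T -> T) : {in A &, injective f} ->
  exists h : {perm T}, {in A, h =1 f}.
Proof.
elim: {A}_.+1 {-2}A (ltnSn #|A|) => // n IH A cA fi.
have [->|[a aA]] := set_0Vmem A; first by exists 1 => x; rewrite inE.
have cA' : #|A :\ a| < n by move: cA; rewrite (cardsD1 a) aA.
have fi' : {in A :\ a &, injective f} by move=> x y /setD1P[_ xA] /setD1P[_ yA]; apply: fi.
have [h hf] := IH _ cA' fi'.
exists (h * tperm (h a) (f a)) => x xA; rewrite permM.
have [->|xa] := eqVneq x a; first by rewrite tpermL.
have hx : h x = f x by rewrite hf // !inE xa.
rewrite tpermD ?hx //; last by apply: contraNneq xa => /fi ->.
by rewrite -hx (inj_eq (@perm_inj _ h)) eq_sym.
Qed.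

Lemma pairs_perm Z (L : seq (T * T)) :
    uniq (unzip1 L) -> uniq (unzip2 L) -> unzip1 L =i Z -> unzip2 L =i Z ->
  exists2 p : {perm T}, perm_on Z p & forall x y, (x, y) \in L -> p x = y.
Proof.
move=> u1 u2 e1 e2.
pose f x := if x \in Z then nth x (unzip2 L) (index x (unzip1 L)) else x.
have sz : size (unzip1 L) = size (unzip2 L) by rewrite !size_map.
have fL x y : (x, y) \in L -> f x = y.
  move=> xyL; rewrite /f -e1 (map_f fst xyL).
  move: xyL => /(nthP (x, y))[i iL xyi].
  have xi : x = nth x (unzip1 L) i by rewrite (nth_map (x, y)) // xyi.
  by rewrite {2}xi index_uniq ?size_map // (nth_map (x, y)) // xyi.
have LZ x : x \in Z -> exists2 y, (x, y) \in L & y \in Z.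
  rewrite -e1 => /mapP[[a b] abL ->]; exists b => //.
  by rewrite -e2; apply: (map_f snd abL).
have Li x x' y : (x, y) \in L -> (x', y) \in L -> x = x'.
  move=> /(nthP (x, y))[i iL ei] /(nthP (x, y))[j jL ej].
  suff ij : i = j by move: ej; rewrite -ij ei => -[].
  apply/eqP; rewrite -(nth_uniq y _ _ u2) ?size_map //.
  by rewrite !(nth_map (x, y)) // ei ej.
have [|h hf] := @extend_perm setT f.
  move=> x x' _ _; have [xZ|xZ] := boolP (x \in Z); have [xZ'|xZ'] := boolP (x' \in Z).
  - have [y Ly yZ] := LZ _ xZ; have [y' Ly' yZ'] := LZ _ xZ'.
    rewrite (fL _ _ Ly) (fL _ _ Ly') => yy; rewrite -{}yy in Ly'.
    exact: Li Ly Ly'.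
  - have [y Ly yZ] := LZ _ xZ; rewrite (fL _ _ Ly) /f (negPf xZ') => e.
    by move: xZ'; rewrite -e yZ.
  - have [y Ly yZ] := LZ _ xZ'; rewrite (fL _ _ Ly) /f (negPf xZ) => e.
    by move: xZ; rewrite e yZ.
  - by rewrite /f (negPf xZ) (negPf xZ').
exists h => [|x y /fL <-]; last by rewrite hf ?inE.
by apply/subsetP => x; rewrite inE; apply: contraR => xZ; rewrite hf ?inE // /f (negPf xZ).
Qed.

End Extend.

(** * Partial injections as disjoint chains and cycles, and their conjugacy *)

Section Blocks.
Variables (T : finType) (Z : {set T}).
Implicit Types (g : {perm T}) (b : T * nat).

Definition run g b := [seq iter j g b.1 | j <- iota 0 b.2].

Lemma runP g b z : reflect (exists2 j, j < b.2 & z = iter j g b.1) (z \in run g b).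
Proof.
apply: (iffP mapP) => -[j]; first by rewrite mem_iota add0n => jb ->; exists j.
by move=> jb ->; exists j => //; rewrite mem_iota.
Qed.

(* [O] lists the chains and [C] the cycles of the restriction of [g] to [D],
   each given by its first point and its length. *)
Definition decomposition g (D : {set T}) (O C : seq (T * nat)) :=
  [/\ perm_eq (flatten [seq run g b | b <- O ++ C]) (enum Z),
      all (fun b => 0 < b.2) (O ++ C),
      {in O, forall b j, j < b.2 -> (iter j g b.1 \in D) = (j.+1 < b.2)}
    & {in C, forall b, iter b.2 g b.1 = b.1 /\ forall j, j < b.2 -> iter j g b.1 \in D}].

Lemma decomposition_perm g D O C O' C' : perm_eq O O' -> perm_eq C C' ->
  decomposition g D O C -> decomposition g D O' C'.
Proof.
move=> eO eC [h1 h2 h3 h4]; have eOC : perm_eq (O ++ C) (O' ++ C') by apply: perm_cat.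
split.
- by rewrite -(permPl (perm_flatten (perm_map _ eOC))).
- by rewrite -(perm_all _ eOC).
- by move=> b; rewrite -(perm_mem eO); apply: h3.
- by move=> b; rewrite -(perm_mem eC); apply: h4.
Qed.

Lemma decomposition_exists g (D : {set T}) :
    (forall z, z \in D -> z \in Z /\ g z \in Z) ->
  exists O C, decomposition g D O C.
Proof.
elim: {D}_.+1 {-2}D (ltnSn #|D|) => // n IH D cD DZ.
have [->|[z zD]] := set_0Vmem D.
  exists [seq (z, 1%N) | z <- enum Z], [::]; split=> //.
  - rewrite cats0 -map_comp (eq_map (g := fun z => [:: z])) ?flatten_seq1 //.
  - by rewrite cats0 all_map; apply/allP.
  - by move=> b /mapP[x _ ->] /= j; rewrite ltnS leqn0 => /eqP ->; rewrite inE.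
have cD' : #|D :\ z| < n by move: cD; rewrite (cardsD1 z) zD.
have [|O [C [hp ha hO hC]]] := IH _ cD'; first by move=> x /setD1P[_ /DZ].
have [zZ gzZ] := DZ _ zD.
have un : uniq (flatten [seq run g b | b <- O ++ C]) by rewrite (perm_uniq hp) enum_uniq.
have inb y : y \in Z -> exists2 b, b \in O ++ C & y \in run g b.
  by rewrite -mem_enum -(perm_mem hp) => /flatten_mapP.
have [b bOC /runP[j jb zj]] := inb z zZ.
have bO : b \in O.
  move: bOC; rewrite mem_cat => /orP[//|/hC[_ /(_ j jb)]].
  by rewrite -zj !inE eqxx.
have jb1 : j.+1 = b.2.
  by have := hO b bO j jb; rewrite -zj !inE eqxx /= => h; apply/eqP; rewrite eqn_leq jb leqNgt -h.
have [b' bOC' /runP[j' jb' gzj]] := inb (g z) gzZ.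
have j'0 : j' = 0%N.
  case: j' gzj jb' => // j' /= /perm_inj zj' jb'.
  move: bOC'; rewrite mem_cat => /orP[h|/hC[_ /(_ j' (ltnW jb'))]].
    by have := hO b' h j' (ltnW jb'); rewrite -zj' jb' !inE eqxx.
  by rewrite -zj' !inE eqxx.
rewrite {}j'0 /= in gzj jb'.
have bO' : b' \in O.
  move: bOC'; rewrite mem_cat => /orP[//|h].
  have [e h'] := hC _ h; move: e h'; rewrite -gzj; case: b'.2 jb' => // m _ /= /perm_inj e.
  by move=> /(_ m (ltnSn m)); rewrite e !inE eqxx.
have pO := perm_to_rem bO.
have other c : c \in rem b O ++ C -> forall k, k < c.2 -> iter k g c.1 != z.
  move=> cO k kc; apply/eqP => ez.
  have eOC : perm_eq (O ++ C) (b :: (rem b O ++ C)) by rewrite -cat_cons perm_cat2r.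
  move: un; rewrite (perm_uniq (perm_flatten (perm_map _ eOC))) /= cat_uniq.
  case/and3P => _ /hasP[]; exists z; last by apply/runP; exists j.
  by apply/flatten_mapP; exists c => //; apply/runP; exists k.
have memD c : c \in rem b O ++ C -> forall k, k < c.2 -> (iter k g c.1 \in D) = (iter k g c.1 \in D :\ z).
  by move=> h k hk; rewrite in_setD1 (other _ h).
have remO c : c \in rem b O -> c \in O by apply: mem_rem.
have [ebb|nbb] := eqVneq b' b.
  exists (rem b O), (b :: C); split.
  - apply: perm_trans hp; apply: perm_flatten; apply: perm_map.
    rewrite -cat1s perm_catCA /= -cat_cons perm_cat2r perm_sym //.
  - apply/allP => c; rewrite mem_cat inE => h; apply: (allP ha).
    by rewrite mem_cat; case/or3P: h => [/remO ->|/eqP ->|->]; rewrite ?bO ?orbT.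
  - move=> c cO k kc; rewrite memD ?hO ?mem_cat ?cO //; exact: remO.
  - move=> c; rewrite inE => /orP[/eqP ->|cC].
      split; first by rewrite -jb1 iterS -zj gzj ebb.
      move=> k kb; have [->|kj] := eqVneq k j; first by rewrite -zj.
      have := hO b bO k kb; rewrite -jb1 ltnS ltn_neqAle kj -ltnS jb1 kb /=.
      by rewrite inE => /andP[].
    have [h1 h2] := hC _ cC; split=> // k kc.
    by have := h2 k kc; rewrite inE => /andP[].
have b'r : b' \in rem b O.
  by have := bO'; rewrite (perm_mem pO) inE (negPf nbb).
have pr := perm_to_rem b'r.
set O2 := rem b' (rem b O).
have pO2 : perm_eq O [:: b, b' & O2] by rewrite (permPl pO) perm_cons.
have subO2 c : c \in O2 -> c \in rem b O by apply: mem_rem.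
exists ((b.1, b.2 + b'.2)%N :: O2), C; split.
- apply: perm_trans hp; rewrite perm_sym.
  have eOC : perm_eq (O ++ C) [:: b, b' & O2 ++ C] by rewrite -!cat_cons perm_cat2r.
  rewrite (permPl (perm_flatten (perm_map _ eOC))) /=.
  rewrite /run /= iotaD [X in perm_eq _ (X ++ _)]map_cat add0n -catA perm_cat2l perm_cat2r.
  rewrite (_ : iota b.2 b'.2 = map (addn b.2) (iota 0 b'.2)); last by rewrite -iotaDl addn0.
  rewrite -map_comp [X in perm_eq _ X](_ : _ = map (fun j => iter j g b'.1) (iota 0 b'.2)) //.
  apply: eq_map => k /=; by rewrite addnC iterD -jb1 iterS -zj gzj.
- apply/allP => c; rewrite /= inE mem_cat => /or3P[/eqP ->|/subO2/remO h|h] /=.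
  + by rewrite -jb1.
  + by apply: (allP ha); rewrite mem_cat h.
  + by apply: (allP ha); rewrite mem_cat h orbT.
- move=> c; rewrite inE => /orP[/eqP -> /= k kb|/subO2 cO k kc]; last first.
    rewrite memD ?hO ?mem_cat ?cO //; exact: remO.
  have [kb2|kb2] := ltnP k b.2.
    rewrite (_ : (k.+1 < b.2 + b'.2)%N = true); last by rewrite -[k.+2]addn1 leq_add.
    have [->|kj] := eqVneq k j; first by rewrite -zj.
    have := hO b bO k kb2; rewrite -jb1 ltnS ltn_neqAle kj -ltnS jb1 kb2 /=.
    by rewrite inE => /andP[].
  have -> : iter k g b.1 = iter (k - b.2) g b'.1.
    by rewrite -{1}(subnK kb2) iterD -jb1 iterS -zj gzj.
  have kk : k - b.2 < b'.2 by rewrite ltn_subLR.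
  by rewrite memD ?mem_cat ?b'r // hO // -subSn // ltn_subLR // leqW.
- move=> c cC; have [h1 h2] := hC _ cC; split=> // k kc.
  by rewrite memD ?mem_cat ?cC ?orbT //; apply: h2.
Qed.

Lemma zip_sizes (O O' : seq (T * nat)) : map snd O = map snd O' ->
  exists L : seq (T * T * nat),
    O = [seq (q.1.1, q.2) | q <- L] /\ O' = [seq (q.1.2, q.2) | q <- L].
Proof.
elim: O O' => [|[x l] O IH] [|[x' l'] O'] //= => [_|[<- /IH[L [-> ->]]]]; first by exists [::].
by exists ((x, x', l) :: L).
Qed.

(** The analogue of conjugacy by cycle type: [p] matches runs of equal length point by point, so it
    carries one partial injection to the other. *)
Lemma decomposition_conj g g' D D' O C O' C' :
    decomposition g D O C -> decomposition g' D' O' C' ->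
    map snd O = map snd O' -> map snd C = map snd C' ->
  exists2 p : {perm T}, perm_on Z p &
    {in Z, forall z, (z \in D) = (p z \in D') /\ (z \in D -> p (g z) = g' (p z))}.
Proof.
move=> [hp ha hO hC] [hp' ha' hO' hC'] /zip_sizes[L1 [eO eO']] /zip_sizes[L2 [eC eC']].
pose P := flatten [seq [seq (iter j g q.1.1, iter j g' q.1.2) | j <- iota 0 q.2] | q <- L1 ++ L2].
have P1 : unzip1 P = flatten [seq run g b | b <- O ++ C].
  rewrite /unzip1 /P map_flatten -map_comp eO eC -map_cat -map_comp.
  by congr flatten; apply: eq_map => q /=; rewrite -map_comp.
have P2 : unzip2 P = flatten [seq run g' b | b <- O' ++ C'].
  rewrite /unzip2 /P map_flatten -map_comp eO' eC' -map_cat -map_comp.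
  by congr flatten; apply: eq_map => q /=; rewrite -map_comp.
have [||||p pZ pP] := @pairs_perm _ Z P.
- by rewrite P1 (perm_uniq hp) enum_uniq.
- by rewrite P2 (perm_uniq hp') enum_uniq.
- by move=> x; rewrite P1 (perm_mem hp) mem_enum.
- by move=> x; rewrite P2 (perm_mem hp') mem_enum.
exists p => // z zZ.
have inP q j : q \in L1 ++ L2 -> j < q.2 -> p (iter j g q.1.1) = iter j g' q.1.2.
  move=> qL jq; apply: pP; apply/flatten_mapP; exists q => //.
  by apply/mapP; exists j; rewrite ?mem_iota.
have : z \in unzip1 P by rewrite P1 (perm_mem hp) mem_enum.
case/mapP => -[z1 z2] /flatten_mapP[q qL /mapP[j]].
rewrite mem_iota add0n => /= jq [ez1 _] ez; rewrite {}ez {}ez1 in zZ *.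
rewrite inP //; move: (qL); rewrite mem_cat => /orP[q1|q2].
  have bO : (q.1.1, q.2) \in O by rewrite eO; apply/mapP; exists q.
  have bO' : (q.1.2, q.2) \in O' by rewrite eO'; apply/mapP; exists q.
  rewrite (hO _ bO) // (hO' _ bO') //; split=> //= jq'.
  by rewrite -!iterS inP.
have bC : (q.1.1, q.2) \in C by rewrite eC; apply/mapP; exists q.
have bC' : (q.1.2, q.2) \in C' by rewrite eC'; apply/mapP; exists q.
have [/= e1 h1] := hC _ bC; have [/= e2 h2] := hC' _ bC'.
rewrite h1 // h2 //; split=> // _; rewrite -!iterS.
have [jq'|jq'] := ltnP j.+1 q.2; first by rewrite inP.
have -> : j.+1 = q.2 by apply/eqP; rewrite eqn_leq jq jq'.
rewrite e1 e2; apply: (inP q 0%N) => //; exact: leq_ltn_trans jq.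
Qed.

End Blocks.

Section SizesKey.
Local Open Scope nat_scope.
Variable u : nat.
Hypothesis u_gt0 : 0 < u.
Implicit Types s : seq nat.

Definition sizes_key : finType :=
  ({ffun 'I_u -> 'I_(u * u).+1} * {ffun 'I_u -> 'I_(u * u).+1})%type.

(* A multiset of positive sizes of total at most [u * u] has at most [u] members
   which are at least [u]: they are listed, and the small ones are counted. *)
Definition key_of_sizes s : sizes_key :=
  ([ffun l : 'I_u => inord (count_mem (l : nat) s)],
   [ffun j : 'I_u => inord (nth 0 (sort leq [seq l <- s | u <= l]) j)]).

Lemma sumn_size_le m s : all (fun l => m <= l) s -> m * size s <= sumn s.
Proof.
elim: s => [_|l s IH /= /andP[ml /IH h]]; first by rewrite muln0.
by rewrite mulnS leq_add.
Qed.

Lemma sumn_filter_le (a : pred nat) s : sumn (filter a s) <= sumn s.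
Proof. by elim: s => //= l s IH; case: (a l) => /=; lia. Qed.

Lemma mem_le_sumn l s : l \in s -> l <= sumn s.
Proof. by elim: s => //= m s IH; rewrite inE => /orP[/eqP ->|/IH]; lia. Qed.

Lemma key_of_sizes_inj s s' : all (leq 1) s -> all (leq 1) s' ->
    sumn s <= u * u -> sumn s' <= u * u ->
  key_of_sizes s = key_of_sizes s' -> perm_eq s s'.
Proof.
move=> p p' b b' [/ffunP e1 /ffunP e2].
have szle t : all (leq 1) t -> sumn t <= u * u -> size t <= u * u.
  by move=> /sumn_size_le h; apply: leq_trans; rewrite mul1n in h.
pose big t := sort leq [seq l <- t | u <= l].
have big_mem t l : l \in big t -> (l \in t) && (u <= l).
  by rewrite mem_sort mem_filter andbC.
have big_sz t : sumn t <= u * u -> size (big t) <= u.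
  move=> h; rewrite -(leq_pmul2l u_gt0) size_sort.
  apply: leq_trans (leq_trans (sumn_filter_le (leq u) t) h).
  by apply: sumn_size_le; apply: filter_all.
have big_nth t j : sumn t <= u * u -> nth 0 (big t) j <= u * u.
  move=> h; have [hj|hj] := ltnP j (size (big t)); last by rewrite nth_default.
  have /big_mem/andP[/mem_le_sumn + _] := mem_nth 0 hj.
  by move=> /leq_trans; apply.
have big_pos t j : j < size (big t) -> 0 < nth 0 (big t) j.
  by move=> hj; have /big_mem/andP[_] := mem_nth 0 hj; apply: leq_trans.
have e2' j : j < u -> nth 0 (big s) j = nth 0 (big s') j.
  move=> hj; have := congr1 val (e2 (Ordinal hj)).
  by rewrite !ffunE /= !inordK // ltnS big_nth.
(* Listed sizes are at least [u > 0], so the default 0 of [nth] marks the end of the list and the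
   lengths agree too. *)
have ebig : big s = big s'.
  apply: (@eq_from_nth _ 0) => [|j hj]; last first.
    by apply: e2'; apply: leq_trans hj _; apply: big_sz.
  apply/eqP; rewrite eqn_leq; apply/andP; split; rewrite leqNgt; apply/negP => h.
    have := big_pos _ _ h; rewrite e2' ?nth_default //.
    by apply: leq_trans h _; apply: big_sz.
  have := big_pos _ _ h; rewrite -e2' ?nth_default //.
  by apply: leq_trans h _; apply: big_sz.
apply/allP => l _ /=; apply/eqP; have [lu|lu] := ltnP l u.
  have := congr1 val (e1 (Ordinal lu)); rewrite !ffunE /= !inordK // ltnS.
    by apply: leq_trans (count_size _ _) _; apply: szle.
  by apply: leq_trans (count_size _ _) _; apply: szle.
have H t : count_mem l t = count_mem l (big t).
  rewrite /big (seq.permP (permEl (perm_sort _ _))) count_filter.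
  by apply: eq_count => x /=; case: eqVneq => // ->.
by rewrite (H s) (H s') ebig.
Qed.

Definition coset_key : finType :=
  ((bool * bool * bool) * (sizes_key * sizes_key))%type.

Lemma card_coset_key : #|coset_key| = (8 * (u * u).+1 ^ (4 * u))%N.
Proof.
rewrite card_prod !card_prod !card_bool !card_ffun !card_ord -!expnD.
by congr (_ * _ ^ _)%N; clear; lia.
Qed.

End SizesKey.

Section DoubleCosets.
Variables (T : finType) (Z : {set T}).
Implicit Types g k h x : {perm T}.

(** A double coset of the pointwise stabilizer of [Z] is a partial injection of [Z]: choose [h]
    fixing [Z] and sending each [g z] to [g' z]; then [g * h] and [g'] agree on [Z], so they differ
    by a factor fixing [Z]. *)
Lemma double_coset_eq g g' :
    {in Z, forall z, (g z \in Z) = (g' z \in Z) /\ (g z \in Z -> g z = g' z)} ->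
  exists k h, [/\ perm_on (~: Z) k, perm_on (~: Z) h & g' = k * g * h].
Proof.
move=> gg'.
pose f y := if y \in Z then y else g' (g^-1 y).
have fZ z : z \in Z -> f (g z) = g' z.
  by move=> zZ; rewrite /f; have [e h] := gg' z zZ; case: ifP => [/h|]; rewrite ?permK.
have fi : {in Z :|: g @: Z &, injective f}.
  have K y : y \in Z :|: g @: Z -> y \notin Z -> f y \notin Z /\ f y = g' (g^-1 y).
    rewrite inE => /orP[->//|/imsetP[z zZ ->]] gzZ; rewrite fZ // permK; split=> //.
    by have [<- _] := gg' z zZ.
  move=> y y' hy hy'; have [yZ|/(K _ hy)[n1 e1]] := boolP (y \in Z);
    have [yZ'|/(K _ hy')[n2 e2]] := boolP (y' \in Z).
  - by rewrite /f yZ yZ'.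
  - by rewrite {1}/f yZ => e; rewrite -e yZ in n2.
  - by rewrite {2}/f yZ' => e; rewrite e yZ' in n1.
  - by rewrite e1 e2 => /perm_inj/perm_inj.
have [h hf] := extend_perm fi.
have hZ : perm_on (~: Z) h.
  apply/subsetP => y; rewrite !inE; apply: contra => yZ.
  by rewrite hf ?inE ?yZ // /f yZ.
exists (g' * (g * h)^-1), h; split=> //; last by rewrite -mulgA mulgKV.
apply/subsetP => y; rewrite !inE; apply: contra => yZ.
rewrite permM; apply/eqP/(canLR (permK _)).
by rewrite permM hf ?fZ // inE; apply/orP; right; apply: imset_f.
Qed.

Definition inner g := [set z in Z | g z \in Z].

Lemma chain_sizes_exists g : exists OC : seq (T * nat) * seq (T * nat),
  [/\ decomposition Z g (inner g) OC.1 OC.2, sorted leq (map snd OC.1)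
    & sorted leq (map snd OC.2)].
Proof.
have [z|O [C dec]] := @decomposition_exists _ Z g (inner g).
  by rewrite inE => /andP[-> ->].
exists (sort (relpre snd leq) O, sort (relpre snd leq) C); split.
- by apply: decomposition_perm dec; rewrite perm_sym perm_sort.
- by rewrite -sort_map; apply: sort_sorted; apply: leq_total.
- by rewrite -sort_map; apply: sort_sorted; apply: leq_total.
Qed.

Definition blocks_of g := projT1 (cid (chain_sizes_exists g)).
Definition open_sizes g := map snd (blocks_of g).1.
Definition closed_sizes g := map snd (blocks_of g).2.

Lemma sizes_bounds g : [/\ all (leq 1) (open_sizes g), all (leq 1) (closed_sizes g)
  & sumn (open_sizes g) + sumn (closed_sizes g) = #|Z|].
Proof.
rewrite /open_sizes /closed_sizes /blocks_of; case: cid => -[O C] /= [[hp ha _ _] _ _].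
move: ha; rewrite all_cat !all_map => /andP[-> ->]; split=> //.
rewrite -sumn_cat -map_cat cardE -(perm_size hp) size_flatten /shape -map_comp.
by congr sumn; apply: eq_map => b /=; rewrite size_map size_iota.
Qed.

Lemma same_sizes g g' : perm_eq (open_sizes g) (open_sizes g') ->
    perm_eq (closed_sizes g) (closed_sizes g') ->
  exists k x h, [/\ perm_on (~: Z) k, perm_on Z x, perm_on (~: Z) h & g' = k * g ^ x * h].
Proof.
rewrite /open_sizes /closed_sizes /blocks_of; case: cid => -[O C] /= [d s1 s2].
case: cid => -[O' C'] /= [d' s1' s2'] e1 e2.
have E s s' : sorted leq s -> sorted leq s' -> perm_eq s s' -> s = s'.
  by apply: sorted_eq => //; [apply: leq_trans | apply: anti_leq].
have [x xZ xP] := decomposition_conj d d' (E _ _ s1 s1' e1) (E _ _ s2 s2' e2).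
have [y yZ|k [h [kZ hZ ->]]] := @double_coset_eq (g ^ x) g'; last by exists k, x, h.
have [z zZ ->] : exists2 z, z \in Z & y = x z.
  exists (x^-1 y); last by rewrite permKV.
  by rewrite -(perm_closed _ xZ) permKV.
have [e1' e2'] := xP z zZ; rewrite permJ perm_closed //.
have xzZ : x z \in Z by rewrite perm_closed.
move: e1' e2'; rewrite !inE zZ xzZ /= => -> e2'; split=> //.
Qed.

Variable u : nat.
Hypotheses (u_gt0 : 0 < u) (cZ : #|Z| <= (u * u)%N).

(* Two permutations with the same block sizes are related by an element of
   [Sym (~: Z) * Sym Z * Sym (~: Z)]; recording the three signs of the element
   leading from a fixed representative makes this element even. *)
Lemma coset_key_exists : exists key : {perm T} -> coset_key u,
  forall g g', key g = key g' ->
  exists k x h, [/\ perm_on (~: Z) k, perm_on Z x, perm_on (~: Z) h, g' = k * g ^ x * h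
    & [/\ k = false :> bool, x = false :> bool & h = false :> bool]].
Proof.
pose key0 g := (key_of_sizes u (open_sizes g), key_of_sizes u (closed_sizes g)).
pose rep g : {perm T} := odflt 1 [pick g0 | key0 g0 == key0 g].
have rep_key g g' : key0 g = key0 g' -> rep g = rep g' by rewrite /rep => ->.
have key_rep g : key0 (rep g) = key0 g.
  by rewrite /rep; case: pickP => [g0 /eqP //|/(_ g)]; rewrite eqxx.
have trE g : exists t : {perm T} * {perm T} * {perm T}, [/\ perm_on (~: Z) t.1.1,
    perm_on Z t.1.2, perm_on (~: Z) t.2 & g = t.1.1 * rep g ^ t.1.2 * t.2].
  have e1 := congr1 fst (key_rep g); have e2 := congr1 snd (key_rep g).
  have [p1 q1 s1] := sizes_bounds (rep g); have [p2 q2 s2] := sizes_bounds g.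
  have [||k [x [h [? ? ? ?]]]] := @same_sizes (rep g) g; last by exists (k, x, h).
    by apply: (key_of_sizes_inj u_gt0 _ _ _ _ e1) => //; lia.
  by apply: (key_of_sizes_inj u_gt0 _ _ _ _ e2) => //; lia.
pose t g := projT1 (cid (trE g)).
have tP g : [/\ perm_on (~: Z) (t g).1.1,
    perm_on Z (t g).1.2, perm_on (~: Z) (t g).2 & g = (t g).1.1 * rep g ^ (t g).1.2 * (t g).2].
  by rewrite /t; case: cid.
exists (fun g => (((t g).1.1 : bool, (t g).1.2 : bool, (t g).2 : bool), key0 g)).
move=> g g' /pair_equal_spec[/pair_equal_spec[/pair_equal_spec[e1 e2] e3] /rep_key er].
have [k1 x1 h1 eg] := tP g; have [k2 x2 h2 eg'] := tP g'.
move: (t g) (t g') e1 e2 e3 k1 x1 h1 k2 x2 h2 eg eg' => [[k x] h] [[k' x'] h'] /=.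
move=> e1 e2 e3 k1 x1 h1 k2 x2 h2 eg eg'.
have VZ (A : {set T}) (s : {perm T}) : perm_on A s -> perm_on A s^-1 by move/perm_onV.
exists (k' * k^-1), (x^-1 * x'), (h^-1 * h'); split.
- by apply: perm_onM => //; apply: VZ.
- by apply: perm_onM => //; apply: VZ.
- by apply: perm_onM => //; apply: VZ.
(* Conjugation by a permutation of [Z] leaves [k] and [h] alone, so inside [g] it only replaces [x]
   by [x']. *)
- have comm (s r : {perm T}) : perm_on Z s -> perm_on (~: Z) r -> r ^ s = r.
    move=> sZ rZ; apply/permP => y; rewrite -[y](permKV s) permJ.
    have [yZ|yZ] := boolP (s^-1 y \in Z).
      rewrite [r _](out_perm rZ) ?inE ?yZ //; rewrite permKV [r y](out_perm rZ) //.
      by rewrite inE negbK -(perm_closed _ (VZ _ _ sZ)).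
    have ys : s^-1 y = y.
      by rewrite (out_perm (VZ _ _ sZ)) // -(perm_closed _ (VZ _ _ sZ)).
    rewrite ys in yZ *; rewrite (out_perm sZ) ?(out_perm sZ) // ?inE.
    by have := perm_closed y rZ; rewrite !inE yZ.
  rewrite eg' eg 2!conjMg -conjgM mulKVg er.
  have xx : perm_on Z (x^-1 * x') by apply: perm_onM => //; apply: VZ.
  by rewrite (comm _ _ xx k1) (comm _ _ xx h1) !mulgA mulgKV mulgK.
- by rewrite !odd_permM !odd_permV e1 e2 e3 !addbb.
Qed.

End DoubleCosets.

Local Close Scope group_scope.

(** * Elementary estimates: the number of keys is subexponential *)

Section Growth.

Lemma bin_le_exp2 n k : 'C(n, k) <= 2 ^ n.
Proof.
elim: n k => [|n IH] [|k] //; first by rewrite bin0 expn_gt0.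
by rewrite binS expnS mul2n -addnn leq_add.
Qed.

Lemma exp_le_ffact u b : u.+1 ^ b <= (u + b) ^_ b.
Proof.
elim: b => [|b IH]; first by rewrite expn0 ffactn0.
by rewrite addnS ffactSS expnS leq_mul // ltnS leq_addr.
Qed.

(** Bounding the power with exponent [b.+1] by a binomial coefficient costs a constant, and the
    spare factor [u.+1] absorbs it. *)
Lemma poly_le_exp2 b : exists u0, forall u, u0 <= u -> u.+1 ^ b <= 2 ^ u.
Proof.
exists (2 ^ b.+1 * b.+1`!) => u hu.
have h : u.+1 * u.+1 ^ b <= (2 ^ b.+1 * b.+1`!) * 2 ^ u.
  rewrite -expnS; apply: leq_trans (exp_le_ffact _ _) _.
  rewrite -bin_ffact; apply: leq_trans (leq_mul (bin_le_exp2 _ _) (leqnn _)) _.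
  by rewrite expnD [2 ^ u * _]mulnC mulnAC.
rewrite -(leq_pmul2l (ltn0Sn u)); apply: leq_trans h _.
by rewrite leq_mul // leqW.
Qed.

Lemma expn_mono x y k : x <= y -> x ^ k <= y ^ k.
Proof. by case: k => // k; rewrite leq_exp2r. Qed.

(** The left side is [exp (O (u * log u))] for fixed [a], [m], [c], while [u] need only be of the
    order of the square root of [s]. *)
Lemma subexponential a m c : exists s0, forall s, s0 <= s -> exists u,
  [/\ 0 < u, 3 * s + 4 <= u * u & (c * (8 * (u * u).+1 ^ (4 * u)) ^ m) ^ a <= 2 ^ s].
Proof.
pose A := (c + 7 * m) * (6 * a).
have [u0 hu0] := poly_le_exp2 (2 * A).
exists ((u0 + 12) * (u0 + 12)) => s hs.
have ex : exists u, 3 * s + 4 <= u * u by exists (3 * s + 4); nia.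
case: (ex_minnP ex) => u hu umin; exists u.
have u0u : u0 + 12 <= u by nia.
(* Minimality of [u] gives [(u - 1) ^ 2 < 3 * s + 4], and [u >= 12] makes the loss in passing to
   [u * u] harmless. *)
have us : u * u <= 6 * s.
  have : u.-1 * u.-1 < 3 * s + 4 by rewrite ltnNge; apply/negP => /umin; lia.
  nia.
have u_gt0 : 0 < u by lia.
split=> //.
(* In sixth powers it suffices to reach [2 ^ (u * u)], thanks to [us]; hence the factor 6 in [A]. *)
rewrite -(@leq_exp2r _ _ 6) // -!expnM [a * 6]mulnC.
set U := (u * u).+1.
have U2 : 2 <= U by rewrite /U; nia.
have U_gt0 : 0 < U by [].
have h1 : c * (8 * U ^ (4 * u)) ^ m <= U ^ ((c + 7 * m) * u).
  have e8 : 8 <= U ^ (3 * u).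
    by apply: leq_trans (expn_mono 3 U2) _; rewrite leq_pexp2l //; lia.
  have ec : c <= U ^ (c * u).
    apply: leq_trans (_ : 2 ^ c <= _); first by apply: ltnW; apply: ltn_expl.
    by apply: leq_trans (expn_mono c U2) _; rewrite leq_pexp2l // leq_pmulr.
  have e7 : (8 * U ^ (4 * u)) ^ m <= U ^ (7 * m * u).
    have -> : 7 * m * u = (3 * u + 4 * u) * m by lia.
    by rewrite [X in _ <= X]expnM; apply: expn_mono; rewrite expnD leq_mul.
  by rewrite mulnDl expnD leq_mul.
have h2 : (c * (8 * U ^ (4 * u)) ^ m) ^ (6 * a) <= (U ^ A) ^ u.
  rewrite -expnM /A.
  have -> : (c + 7 * m) * (6 * a) * u = ((c + 7 * m) * u) * (6 * a) by lia.
  by rewrite [X in _ <= X]expnM; apply: expn_mono.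
apply: leq_trans h2 _.
have h3 : U ^ A <= 2 ^ u.
  apply: leq_trans (hu0 u _); last lia.
  by rewrite [X in _ <= X]expnM; apply: expn_mono; rewrite /U -mulnn; nia.
apply: leq_trans (_ : (2 ^ u) ^ u <= _); first exact: expn_mono.
by rewrite -expnM leq_pexp2l // mulnC.
Qed.

End Growth.

(** * Irreducible representations of arbitrary groups *)

Local Open Scope ring_scope.

Section Subspaces.
Variable F : fieldType.

(** A row space of maximal rank inside [X] exhausts [X]. This lets irreducibility, stated for
    matrices, be applied to subspaces given by conditions. *)
Lemma subspace_of_pred n (X : 'rV[F]_n -> Prop) :
    X 0 -> (forall a u v, X u -> X v -> X (a *: u + v)) ->
  exists U : 'M[F]_n, forall v, X v <-> (v <= U)%MS.
Proof.
move=> X0 XL.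
pose good r := `[< exists2 U : 'M[F]_n, \rank U = r & forall v, (v <= U)%MS -> X v >].
have ex : exists r, good r.
  exists 0%N; apply/asboolP; exists 0; first exact: mxrank0.
  by move=> v; rewrite submx0 => /eqP ->.
have bd r : good r -> (r <= n)%N by move=> /asboolP[U <- _]; apply: rank_leq_row.
case: (ex_maxnP ex bd) => r /asboolP[U rU UX] rmax.
exists U => v; split; last exact: UX.
move=> Xv; apply: contrapT => /negP vU.
suff : good (\rank (U + v)%MS).
  move=> /rmax; rewrite -rU leqNgt => /negP[].
  by rewrite ltn_neqAle mxrankS ?addsmxSl // andbT; apply: contra vU => /eqP h;
     have := mxrank_leqif_eq (addsmxSl U v); rewrite h => -[_]; rewrite eqxx => /esym/andP[_ ];
     apply: submx_trans (addsmxSr _ _).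
apply/asboolP; exists (U + v)%MS => // w /sub_addsmxP[[a b] ->] /=.
have /sub_rVP[c ->] : (b *m v <= v)%MS by apply: submxMl.
by rewrite addrC; apply: XL => //; apply: UX; apply: submxMl.
Qed.

Lemma row_mulmx_eq0 n m (A : 'M[F]_(n, m)) : (forall v : 'rV_n, v *m A = 0) -> A = 0.
Proof. by move=> h; apply/row_matrixP => i; rewrite rowE h linear0. Qed.

End Subspaces.

Section Schur.
Variables (F : numClosedFieldType) (G : groupType).

Definition intertwines n m (r : G -> 'M[F]_n) (s : G -> 'M[F]_m) (T : 'M[F]_(n, m)) :=
  forall g, r g *m T = T *m s g.

(** For irreducible representations this is non-isomorphism, in a form that compares different
    dimensions without casts. *)
Definition disjoint_reprs n m (r : G -> 'M[F]_n) (s : G -> 'M[F]_m) :=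
  forall T, intertwines r s T -> T = 0.

Lemma irr_subspace n (r : G -> 'M[F]_n) (X : 'rV[F]_n -> Prop) :
    repr_irreducible r -> X 0 -> (forall a u v, X u -> X v -> X (a *: u + v)) ->
    (forall u g, X u -> X (u *m r g)) -> forall u, X u -> u != 0 -> forall v, X v.
Proof.
move=> [n0 irr] X0 XL Xr u Xu u0.
have [U UX] := subspace_of_pred X0 XL.
have : row_full U.
  apply: irr; last by apply: contraNneq u0 => U0; move: Xu; rewrite UX U0 submx0.
  move=> g; apply/row_subP => i; rewrite row_mul; apply/UX/Xr/UX; exact: row_sub.
by move=> /submx_full h v; apply/UX; apply: h.
Qed.

Lemma schur_scalar n (r : G -> 'M[F]_n) T :
  repr_irreducible r -> intertwines r r T -> exists c, T = c%:M.
Proof.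
move=> irr Tr; have [n0 _] := irr.
have [c /eigenvalueP[v vT v0]] := eigenvalue_closed T n0; exists c.
have H := @irr_subspace _ r (fun v => v *m T = c *: v) irr.
apply/eqP; rewrite -subr_eq0; apply/eqP; apply: row_mulmx_eq0 => w.
rewrite mulmxBr mul_mx_scalar; apply/eqP; rewrite subr_eq0; apply/eqP.
apply: (H _ _ _ v vT v0 w) => [|a x y hx hy|x g hx]; first by rewrite mul0mx scaler0.
  by rewrite mulmxDl -scalemxAl hx hy scalerDr scalerA mulrC -scalerA.
by rewrite -mulmxA Tr mulmxA hx scalemxAl.
Qed.

Lemma schur_iso n m (r : G -> 'M[F]_n) (s : G -> 'M[F]_m) T :
    repr_irreducible r -> repr_irreducible s -> intertwines r s T -> T != 0 ->
  n = m /\ row_free T /\ row_full T.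
Proof.
move=> ir is_ Trs T0.
have fr : row_free T.
  apply: inj_row_free => v vT; apply: contrapT => /eqP v0.
  case/eqP: T0; apply: row_mulmx_eq0 => w.
  apply: (irr_subspace (X := fun u => u *m T = 0) ir _ _ _ vT v0 w); first exact: mul0mx.
    by move=> a x y hx hy; rewrite mulmxDl -scalemxAl hx hy scaler0 addr0.
  by move=> x g hx; rewrite -mulmxA Trs mulmxA hx mul0mx.
have fl : row_full T.
  rewrite /row_full -mxrank_gen -/(row_full _); apply: is_.2; last by rewrite -mxrank_eq0 genmxE mxrank_eq0.
  by move=> g; rewrite (eqmx_stable _ (genmxE T)) -Trs; apply: submxMl.
split=> //.
by move: (fr) (fl); rewrite /row_free /row_full => /eqP e1 /eqP e2; rewrite -[LHS]e1.
Qed.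

End Schur.

Section Independence.
Variables (F : numClosedFieldType) (G : groupType) (I : finType) (d : I -> nat).
Variable (r : forall i, G -> 'M[F]_(d i)).
Hypothesis rep : forall i, is_repr (r i).
Hypothesis irr : forall i, repr_irreducible (r i).
Hypothesis dis : forall i j, i != j -> disjoint_reprs (r i) (r j).

Local Notation K := {i : I & 'I_(d i)}.

Let entry (x : forall k : K, 'rV[F]_(d (tag k))) (k : K) g :=
  (x k *m r (tag k) g) 0 (tagged k).

Lemma intertwiner_entry (k0 k : K) (T : 'M[F]_(d (tag k0), d (tag k))) :
  k0 != k -> intertwines (r (tag k0)) (r (tag k)) T -> T (tagged k0) (tagged k) = 0.
Proof.
case: k0 k T => [i l] [j l'] /= T kk Tr.
have [ij|ij] := eqVneq i j; last by rewrite (dis ij Tr) mxE.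
subst j; have [c ->] := schur_scalar (irr i) Tr.
rewrite mxE; case: eqVneq => [e|//]; by rewrite e eqxx in kk.
Qed.

(* Adding one coefficient function at a time: if a new one were dependent, every
   vector would extend to a unique relation, so the relations would be the
   graphs of intertwiners, against Schur. *)
Lemma coef_rows_independent (S : seq K) : uniq S ->
    forall x, (forall g, \sum_(k <- S) entry x k g = 0) -> forall k, k \in S -> x k = 0.
Proof.
elim: S => [//|k0 S IH] /= /andP[k0S uS] x hx.
have {}IH := IH uS.
pose rel (y : 'rV[F]_(d (tag k0))) x' :=
  forall g, (y *m r (tag k0) g) 0 (tagged k0) + \sum_(k <- S) entry x' k g = 0.
have relL a y z x1 x2 : rel y x1 -> rel z x2 -> rel (a *: y + z) (fun k => a *: x1 k + x2 k).
  move=> h1 h2 g.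
  have -> : \sum_(k <- S) entry (fun k => a *: x1 k + x2 k) k g =
      a * \sum_(k <- S) entry x1 k g + \sum_(k <- S) entry x2 k g.
    rewrite mulr_sumr -big_split; apply: eq_bigr => k _ /=.
    by rewrite /entry mulmxDl -scalemxAl !mxE.
  have E (A B : 'rV[F]_(d (tag k0))) j : (a *: A + B) 0 j = a * A 0 j + B 0 j by rewrite !mxE.
  by rewrite mulmxDl -scalemxAl E addrACA -mulrDr h1 h2 mulr0 addr0.
have relG y h x' : rel y x' -> rel (y *m r (tag k0) h) (fun k => x' k *m r (tag k) h).
  move=> hy g; have := hy (h * g)%g; rewrite (rep _).2 mulmxA => hh; rewrite -[RHS]hh.
  by congr (_ + _); apply: eq_bigr => k _; rewrite /entry (rep _).2 mulmxA.
have rel_uniq y x1 x2 : rel y x1 -> rel y x2 -> forall k, k \in S -> x1 k = x2 k.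
  move=> h1 h2 k kS; have := relL (-1) y y x1 x2 h1 h2; rewrite scaleN1r addNr => h.
  have : -1 *: x1 k + x2 k = 0.
    apply: (IH (fun k => -1 *: x1 k + x2 k)) kS => g.
    by have := h g; rewrite mul0mx mxE add0r.
  by move/eqP; rewrite scaleN1r addrC subr_eq0 => /eqP.
have hxr : rel (x k0) x by move=> g; have := hx g; rewrite big_cons.
have [x0|x0] := eqVneq (x k0) 0.
  move=> k; rewrite inE => /orP[/eqP -> //|kS]; apply: IH kS => g.
  by have := hxr g; rewrite x0 mul0mx mxE add0r.
(* The vectors that extend to a relation form an invariant subspace, nonzero because it contains
   [x k0]. *)
have all_rel y : exists x', rel y x'.
  apply: (irr_subspace (X := fun y => exists x', rel y x') (irr _) _ _ _ _ x0).
  - exists (fun k => 0) => g; rewrite mul0mx mxE add0r big1 // => k _.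
    by rewrite /entry mul0mx mxE.
  - by move=> a u v [x1 h1] [x2 h2]; exists (fun k => a *: x1 k + x2 k); apply: relL.
  - by move=> u g [x1 h1]; exists (fun k => x1 k *m r (tag k) g); apply: relG.
  - by exists x.
pose X a := projT1 (cid (all_rel (delta_mx 0 a))).
have XP a : rel (delta_mx 0 a) (X a) by rewrite /X; case: cid.
pose T k : 'M[F]_(d (tag k0), d (tag k)) := \matrix_(a, b) X a k 0 b.
have TP y : rel y (fun k => y *m T k).
  move=> g.
  have -> : \sum_(k <- S) entry (fun k => y *m T k) k g =
      \sum_a y 0 a * \sum_(k <- S) entry (X a) k g.
    under [RHS]eq_bigr do rewrite mulr_sumr.
    rewrite exchange_big; apply: eq_bigr => k _ /=.
    rewrite /entry {1}(row_sum_delta y) !mulmx_suml summxE; apply: eq_bigr => a _.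
    rewrite -!scalemxAl mxE; congr (_ * _).
    suff -> : delta_mx 0 a *m T k = X a k by [].
    by rewrite -rowE; apply/rowP => b; rewrite !mxE.
  rewrite {1}(row_sum_delta y) mulmx_suml summxE -big_split /= big1 // => a _.
  by rewrite -scalemxAl mxE -mulrDr XP mulr0.
have Tint k : k \in S -> intertwines (r (tag k0)) (r (tag k)) (T k).
  move=> kS g; apply/row_matrixP => a; rewrite !rowE !mulmxA.
  exact: (rel_uniq _ _ _ (TP (delta_mx 0 a *m r (tag k0) g)) (relG _ g _ (TP (delta_mx 0 a)))).
(* At the identity the relation extending this basis vector reads 1 plus entries of intertwiners at
   distinct indices, and those entries vanish. *)
have := TP (delta_mx 0 (tagged k0)) 1%g; rewrite (rep _).1 mulmx1 mxE !eqxx /=.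
rewrite big_seq big1 ?addr0 => [/eqP|k kS]; first by rewrite oner_eq0.
rewrite /entry (rep _).1 mulmx1 -rowE mxE; apply: intertwiner_entry; last exact: Tint.
by apply: contraNneq k0S => ->.
Qed.

(** Independence of matrix coefficients in the manner of Frobenius and Schur: the trace splits into
    one row coefficient for each diagonal position. *)
Theorem coef_independent (C : forall i, 'M[F]_(d i)) :
  (forall g, \sum_i \tr (C i *m r i g) = 0) -> forall i, C i = 0.
Proof.
move=> h i; apply/row_matrixP => l; rewrite linear0.
have u : uniq (enum {: K}) by apply: enum_uniq.
apply: (coef_rows_independent u (x := fun k => row (tagged k) (C (tag k))) _ (k := Tagged _ l)).
  move=> g; rewrite -[RHS](h g) big_enum /= sig_big_dep /=.
  by apply: eq_bigr => -[j a] _ /=; rewrite /entry /= -row_mul mxE.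
by rewrite mem_enum.
Qed.

End Independence.

Section Symmetry.
Variables (F : numClosedFieldType) (G : groupType).

Lemma disjoint_reprsC n m (r : G -> 'M[F]_n) (s : G -> 'M[F]_m) :
  repr_irreducible r -> repr_irreducible s -> disjoint_reprs r s -> disjoint_reprs s r.
Proof.
move=> ir is_ dis T Tsr; apply: contrapT => /eqP T0.
have [_ [fr fl]] := schur_iso is_ ir Tsr T0.
have p0 : pinvmx T = 0.
  apply: dis => g; rewrite -[RHS]mulmx1 -(mulmxVp fr) -mulmxA [s g *m _]mulmxA Tsr.
  by rewrite -mulmxA mulmxA mulVpmx // mul1mx.
by case/eqP: T0; rewrite -[T]mulmx1 -(mulVpmx fl) p0 mul0mx mulmx0.
Qed.

Lemma sub_irreducible n (r : G -> 'M[F]_n) : is_repr r -> (0 < n)%N ->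
  exists e (q : G -> 'M[F]_e) (P : 'M[F]_(e, n)),
    [/\ is_repr q, repr_irreducible q, intertwines q r P & row_free P].
Proof.
move=> [r1 rM] n0.
pose good k := `[< exists U : 'M[F]_n, [/\ U != 0, \rank U = k & forall g, stablemx U (r g)] >].
have ex : exists k, good k.
  exists (\rank (1%:M : 'M[F]_n)); apply/asboolP; exists 1%:M; split=> //.
    by rewrite -mxrank_eq0 mxrank1 -lt0n.
  by move=> g; rewrite mul1mx submx1.
case: (ex_minnP ex) => e /asboolP[U [U0 rU stU]] emin.
subst e; set e := \rank U in emin *; pose P := row_base U.
have fP : row_free P by apply: row_base_free.
have stP g : (P *m r g <= P)%MS.
  have := stU g; rewrite -(eqmx_stable (r g) (eq_row_base U)).
  by [].
pose q g := P *m r g *m pinvmx P.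
have qP : intertwines q r P by move=> g; rewrite /q mulmxKpV.
have canc m (A B : 'M[F]_(m, e)) : A *m P = B *m P -> A = B by apply: row_free_inj.
exists e, q, P; split=> //.
  split; first by apply: canc; rewrite qP r1 mul1mx mulmx1.
  by move=> g h; apply: canc; rewrite qP rM mulmxA -(qP g) -mulmxA -(qP h) mulmxA.
split; first by rewrite lt0n mxrank_eq0.
move=> V stV V0; rewrite /row_full eqn_leq rank_leq_col /=.
have -> : \rank V = \rank (V *m P) by rewrite mxrankMfree.
rewrite -mxrank_gen; apply: emin; apply/asboolP; exists <<V *m P>>%MS; split=> //.
  by rewrite -mxrank_eq0 mxrank_gen mxrankMfree // mxrank_eq0.
by move=> g; rewrite (eqmx_stable _ (genmxE _)) -mulmxA -qP mulmxA submxMr.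
Qed.

End Symmetry.

(** * Clifford theory without quotients: how many irreducibles share a constituent *)

Section Clifford.
Variables (F : numClosedFieldType) (G K : groupType) (iota : K -> G).
Variables (J : finType) (t : J -> G) (I : finType) (d : I -> nat).
Variable (r : forall i, G -> 'M[F]_(d i)).
Hypothesis rep : forall i, is_repr (r i).
Hypothesis irr : forall i, repr_irreducible (r i).
Hypothesis dis : forall i j, i != j -> disjoint_reprs (r i) (r j).
(** Modulo the common kernel, [iota] has at most [#|J|] cosets. The index [i] comes last because one
    decomposition of [g] has to serve all representations at once. *)
Hypothesis cover : forall g, exists j a, forall i, r i g = r i (iota a) *m r i (t j).

Variables (e : nat) (q : K -> 'M[F]_e) (P : forall i, 'M[F]_(e, d i)).
Hypothesis Pfree : forall i, row_free (P i).
Hypothesis Pint : forall i, intertwines q (r i \o iota) (P i).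

(* The submodule generated by the diagonal copy of [q] in the sum of the [r i]
   has dimension at most [e * #|J|], and it is everything. *)
Lemma clifford_bound : (0 < e)%N -> (#|I| <= #|J|)%N.
Proof.
move=> e0; rewrite leqNgt; apply/negP => IJ.
pose A j i := P i *m r i (t j) *m pinvmx (P i).
(* A row of [W] is a functional on the copy of [q] in one [r i]; [f W = 0] makes their sum vanish on
   the submodule generated by the diagonal copy. There are [e * #|J|] equations in [e * #|I|]
   unknowns. *)
pose f (W : 'M[F]_(#|I|, e)) : 'M[F]_(#|J|, e) :=
  \matrix_j \sum_i row i W *m (A (enum_val j) (enum_val i))^T.
have f_lin : linear f.
  move=> a X Y; apply/row_matrixP => j; rewrite linearP /= !rowK scaler_sumr -big_split.
  by apply: eq_bigr => i _ /=; rewrite linearP /= mulmxDl -scalemxAl.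
pose flin : {linear 'M[F]_(#|I|, e) -> 'M[F]_(#|J|, e)} :=
  HB.pack f (GRing.isLinear.Build _ _ _ _ f f_lin).
have [W W0 fW] : exists2 W, W != 0 & f W = 0.
  have : kermx (lin_mx flin) != 0.
    rewrite kermx_eq0 /row_free neq_ltn (leq_ltn_trans (rank_leq_col _)) //.
    by rewrite ltn_pmul2r.
  case/rowV0Pn => v; rewrite sub_kermx => /eqP vk v0.
  exists (vec_mx v); first by apply: contra v0 => /eqP h; rewrite -[v]vec_mxK h linear0.
  by apply: (can_inj mxvecK); rewrite linear0 -[f _]/(flin _) -mul_vec_lin vec_mxK.
pose w i : 'cV[F]_e := (row (enum_rank i) W)^T.
have Aw j : \sum_i A j i *m w i = 0.
  have := congr1 (fun B => (row (enum_rank j) B)^T) fW; rewrite rowK enum_rankK !linear0.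
  rewrite linear_sum /= => hh; rewrite -[RHS]hh [LHS](reindex (@enum_val I I)) /=; last first.
    by exists enum_rank => x _; rewrite ?enum_valK ?enum_rankK.
  by apply: eq_bigr => i _; rewrite /w enum_valK trmx_mul trmxK.
pose z i := pinvmx (P i) *m w i.
(* Cyclicity of the trace turns the vanishing of these functionals on the submodule into a relation
   between matrix coefficients of the [r i]. *)
have zu (u : 'rV[F]_e) i : z i *m (u *m P i) = 0.
  move: i; apply: (coef_independent rep irr dis (C := fun i => z i *m (u *m P i))) => g.
  have [j [a ga]] := cover g.
  transitivity (\tr (u *m q a *m \sum_i A j i *m w i)); last by rewrite Aw mulmx0 mxtrace0.
  rewrite mulmx_sumr linear_sum; apply: eq_bigr => i _ /=.
  have -> : A j i *m w i = P i *m r i (t j) *m z i by apply/esym/mulmxA.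
  move: (z i) => zi; rewrite -[_ *m r i g]mulmxA mxtrace_mulC ga; congr (\tr _).
  have -> : u *m q a *m (P i *m r i (t j) *m zi) = u *m (q a *m P i) *m r i (t j) *m zi.
    by rewrite !mulmxA.
  by rewrite Pint /= !mulmxA.
case/eqP: W0; apply/row_matrixP => i; rewrite linear0.
have wi (u : 'rV[F]_e) : w (enum_val i) *m u = 0.
  have := congr1 (fun B => P (enum_val i) *m B *m pinvmx (P (enum_val i))) (zu u (enum_val i)).
  have -> : z (enum_val i) *m (u *m P (enum_val i)) =
    pinvmx (P (enum_val i)) *m (w (enum_val i) *m u) *m P (enum_val i).
    by rewrite /z; move: (pinvmx _) => Q; rewrite !mulmxA.
  move: (w _ *m u) => B; rewrite mulmx0 mul0mx => <-.
  rewrite -[P _ *m (_ *m _) *m _]mulmxA -[_ *m P _ *m pinvmx _]mulmxA mulmxVp //.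
  by rewrite mulmx1 mulmxA mulmxVp // mul1mx.
apply/rowP => l; have := congr1 (fun B : 'M[F]_e => B l (Ordinal e0)) (wi (delta_mx 0 (Ordinal e0))).
by rewrite !mxE big_ord1 /w enum_valK !mxE !eqxx mulr1.
Qed.

End Clifford.

(** * Irreducibles with a vector fixed by [H], counted by double cosets *)

Section FixedVectors.
Variables (F : numClosedFieldType) (K : finGroupType) (H : {group K}).
Variables (I : finType) (d : I -> nat) (r : forall i, K -> 'M[F]_(d i)).
Hypothesis rep : forall i, is_repr (r i).
Hypothesis irr : forall i, repr_irreducible (r i).
Hypothesis dis : forall i j, i != j -> disjoint_reprs (r i) (r j).
Hypothesis fixed : forall i, exists2 v : 'rV[F]_(d i), v != 0 & forall h, h \in H -> v *m r i h = v.
Variables (X : finType) (key : K -> X).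
Hypothesis keyP : forall g g', key g = key g' ->
  exists h x h', [/\ h \in H, x \in 'N(H)%g, h' \in H & g' = (h * g ^ x * h')%g].

(** This is [#|H|] times the projection onto the [H]-fixed vectors; the scalar does not affect
    linear independence. *)
Let E i := \sum_(h in H) r i h.

Lemma E_neq0 i : E i != 0.
Proof.
have [v v0 vH] := fixed i; apply: contraNneq v0 => E0.
have : v *m E i = #|H|%:R *: v.
  rewrite mulmx_sumr (eq_bigr (fun=> v)) // sumr_const scaler_nat.
  by [].
rewrite E0 mulmx0 => /esym/eqP; rewrite scaler_eq0 pnatr_eq0.
by rewrite -[#|H| == 0%N]negbK -lt0n cardG_gt0.
Qed.

Lemma E_mull i h : h \in H -> r i h *m E i = E i.
Proof.
move=> hH; rewrite mulmx_sumr [RHS](reindex_inj (mulgI h)) /=.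
rewrite [RHS](eq_bigl (fun k => k \in H)) => [|k]; last by rewrite groupMl.
by apply: eq_bigr => k _; rewrite (rep i).2.
Qed.

Lemma E_mulr i h : h \in H -> E i *m r i h = E i.
Proof.
move=> hH; rewrite mulmx_suml [RHS](reindex_inj (mulIg h)) /=.
rewrite [RHS](eq_bigl (fun k => k \in H)) => [|k]; last by rewrite groupMr.
by apply: eq_bigr => k _; rewrite (rep i).2.
Qed.

Lemma E_conj i x : x \in 'N(H)%g -> r i x^-1%g *m E i *m r i x = E i.
Proof.
move=> xN; rewrite mulmx_sumr mulmx_suml [RHS](reindex_inj (conjg_inj x)) /=.
rewrite [RHS](eq_bigl (fun k => k \in H)) => [|k]; last by rewrite memJ_norm.
by apply: eq_bigr => k _; rewrite -!(rep i).2 -mulgA -conjgE.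
Qed.

Lemma E_trace i g g' : key g = key g' -> \tr (E i *m r i g) = \tr (E i *m r i g').
Proof.
move=> /keyP[h [x [h' [hH xN h'H ->]]]].
rewrite conjgE !(rep i).2 !mulmxA (E_mulr i hH) [RHS]mxtrace_mulC !mulmxA (E_mull i h'H).
rewrite [RHS]mxtrace_mulC !mulmxA; congr (\tr (_ *m _)).
have xN' : x^-1%g \in 'N(H)%g by rewrite groupV.
by have := E_conj i xN'; rewrite invgK.
Qed.

Theorem fixed_vector_bound : (#|I| <= #|X|)%N.
Proof.
rewrite leqNgt; apply/negP => XI.
(* The coefficient functions descend to keys. A key that is not attained gets the junk value 0, and
   the relation is read off at attained keys only. *)
pose f i k := if [pick g | key g == k] is Some g then \tr (E i *m r i g) else 0.
have fE i g : f i (key g) = \tr (E i *m r i g).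
  by rewrite /f; case: pickP => [g' /eqP/(E_trace i) //|/(_ g)]; rewrite eqxx.
pose M : 'M[F]_(#|I|, #|X|) := \matrix_(i, k) f (enum_val i) (enum_val k).
have : kermx M != 0.
  by rewrite kermx_eq0 /row_free neq_ltn (leq_ltn_trans (rank_leq_col _)).
case/rowV0Pn => v; rewrite sub_kermx => /eqP vM v0.
have C0 : forall i, v 0 (enum_rank i) *: E i = 0.
  apply: (coef_independent rep irr dis (C := fun i => v 0 (enum_rank i) *: E i)) => g.
  have := congr1 (fun B : 'rV[F]_#|X| => B 0 (enum_rank (key g))) vM.
  rewrite !mxE => vMg; rewrite -[RHS]vMg [LHS](reindex (@enum_val I I)) /=; last first.
    by exists enum_rank => x _; rewrite ?enum_valK ?enum_rankK.
  apply: eq_bigr => i _; rewrite enum_valK -scalemxAl linearZ /= mxE enum_rankK.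
  by rewrite fE.
case/eqP: v0; apply/rowP => i; have /eqP := C0 (enum_val i).
by rewrite scaler_eq0 (negPf (E_neq0 _)) orbF enum_valK mxE => /eqP.
Qed.

End FixedVectors.

Section Count.
Variables (F : numClosedFieldType) (G : groupType) (K : finGroupType) (iota : K -> G).
Hypothesis iota1 : iota 1%g = 1%g.
Hypothesis iotaM : {morph iota : x y / (x * y)%g}.
Variables (J : finType) (t : J -> G) (H : {group K}) (X : finType) (key : K -> X) (N : nat).
Hypothesis keyP : forall g g', key g = key g' ->
  exists h x h', [/\ h \in H, x \in 'N(H)%g, h' \in H & g' = (h * g ^ x * h')%g].
Hypothesis level : forall n (r : K -> 'M[F]_n), is_repr r -> (0 < n <= N)%N ->
  exists2 v : 'rV[F]_n, v != 0 & forall h, h \in H -> v *m r h = v.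
Variables (I : finType) (d : I -> nat) (r : forall i, G -> 'M[F]_(d i)).
Hypothesis rep : forall i, is_repr (r i).
Hypothesis irr : forall i, repr_irreducible (r i).
Hypothesis dis : forall i j, i != j -> disjoint_reprs (r i) (r j).
Hypothesis dN : forall i, (d i <= N)%N.
Hypothesis cover : forall g, exists j a, forall i, r i g = r i (iota a) *m r i (t j).

(** Every [r i], restricted along [iota], contains an irreducible [q i]. A maximal disjoint family
    among the [q i] has at most [#|X|] members by [fixed_vector_bound], and each member lies in at
    most [#|J|] of the [r i] by [clifford_bound]. *)
Theorem irr_count : (#|I| <= #|J| * #|X|)%N.
Proof.
have sub i : exists x : {e : nat & ((K -> 'M[F]_e) * 'M[F]_(e, d i))%type},
    [/\ is_repr (tagged x).1, repr_irreducible (tagged x).1,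
        intertwines (tagged x).1 (r i \o iota) (tagged x).2 & row_free (tagged x).2].
  have [||e [q [P qP]]] := @sub_irreducible F K (d i) (r i \o iota); last 1 first.
  - by exists (existT _ e (q, P)).
  - by split=> [|x y] /=; rewrite ?iota1 ?iotaM ?(rep i).1 ?(rep i).2.
  - by have [] := irr i.
pose qp i := projT1 (cid (sub i)).
pose e i := tag (qp i); pose q i : K -> 'M[F]_(e i) := (tagged (qp i)).1.
pose P i : 'M[F]_(e i, d i) := (tagged (qp i)).2.
have qP i : [/\ is_repr (q i), repr_irreducible (q i),
    intertwines (q i) (r i \o iota) (P i) & row_free (P i)].
  exact: projT2 (cid (sub i)).
pose indep (S : {set I}) := `[< forall i j, i \in S -> j \in S -> i != j -> disjoint_reprs (q i) (q j) >].
have indep0 : indep set0 by apply/asboolP => i j; rewrite inE.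
case: (@arg_maxnP _ set0 indep (fun S => #|S|) indep0) => S /asboolP Sind Smax.
have SX : (#|S| <= #|X|)%N.
  rewrite -card_sig.
  apply: (@fixed_vector_bound F K H {i | i \in S} (fun i => e (val i)) (fun i => q (val i)))
    keyP => [i|i|[i iS] [j jS] ij|i].
  - by have [] := qP (val i).
  - by have [] := qP (val i).
  - exact: Sind.
  - have [rq iq _ fP] := qP (val i); apply: level => //; have [-> _] := iq.
    by apply: leq_trans (dN (val i)); move: fP; rewrite /row_free => /eqP <-; apply: rank_leq_col.
(* By maximality [q i] is isomorphic to a member of the family, which therefore embeds in [r i]
   itself. *)
have near i : exists s, s \in S /\ exists2 T : 'M[F]_(e s, d i), intertwines (q s) (r i \o iota) T & row_free T.
  have [_ iqi Pi fPi] := qP i.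
  have [iS|iS] := boolP (i \in S); first by exists i; split=> //; exists (P i).
  apply: contrapT => no.
  have iS_dis s : s \in S -> disjoint_reprs (q s) (q i).
    move=> sS T Tint; apply: contrapT => /eqP T0; apply: no; exists s; split=> //.
    have [_ iqs _ _] := qP s; have [_ [fT _]] := schur_iso iqs iqi Tint T0.
    exists (T *m P i); last by rewrite /row_free mxrankMfree.
    by move=> g; rewrite mulmxA Tint -!mulmxA Pi.
  have : indep (i |: S).
    apply/asboolP => j k; rewrite !inE => /orP[/eqP ->|jS] /orP[/eqP ->|kS] jk.
    - by rewrite eqxx in jk.
    - have [_ iqk _ _] := qP k; apply: disjoint_reprsC => //; exact: iS_dis.
    - exact: iS_dis.
    - exact: Sind.
  by move=> /Smax; rewrite cardsU1 iS /= ltnn.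
pose s i := projT1 (cid (near i)).
have sP i : s i \in S /\ exists2 T : 'M[F]_(e (s i), d i), intertwines (q (s i)) (r i \o iota) T & row_free T.
  by rewrite /s; case: cid.
have fiber k : (#|[set i | s i == k]| <= #|J|)%N.
  rewrite -card_sig.
  have [[[i ik]]|no] := pselect (inhabited {i | i \in [set i | s i == k]}); last first.
    by rewrite (eq_card0 (A := {: {i | i \in [set i | s i == k]}})) // => x; case: no.
  have T0 (x : {i | i \in [set i | s i == k]}) :
      exists T : 'M[F]_(e k, d (val x)), intertwines (q k) (r (val x) \o iota) T /\ row_free T.
    case: x => x /= xk; have := xk; rewrite inE => /eqP <-.
    by have [_ [T ? ?]] := sP x; exists T.
  apply: (@clifford_bound F G K iota J t {i | i \in [set i | s i == k]} (fun x => d (val x))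
    (fun x => r (val x)) _ _ _ _ (e k) (q k) (fun x => projT1 (cid (T0 x)))) => //.
  - by move=> [x xS] [y yS] xy; apply: dis.
  - by move=> g; have [j [a h]] := cover g; exists j, a => x; apply: h.
  - by move=> x; case: cid => T [].
  - by move=> x; case: cid => T [].
  - by have [_ [+ _] _ _] := qP k.
rewrite mulnC; apply: leq_trans (_ : #|S| * #|J| <= _)%N; last by rewrite leq_mul2r SX orbT.
rewrite -[leqLHS]sum1_card (partition_big s (fun k => k \in S)) /=; last by move=> i _; have [] := sP i.
rewrite -sum_nat_const; apply: leq_sum => k _; apply: leq_trans (fiber k).
by rewrite sum1_card; apply: subset_leq_card; apply/subsetP => i; rewrite !inE.
Qed.

End Count.

(** * Representations of powers of alternating groups *)

Section SetMapping.
Variable T : finType.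

(** Points of [A] outside [Z] are exchanged with points of [Z] outside [A]; a transposition inside
    [Z] repairs the sign. *)
Lemma perm_into (A Z : {set T}) : (#|A| <= #|Z|)%N -> (1 < #|Z|)%N ->
  exists2 x : {perm T}, x = false :> bool & forall a, a \in A -> x a \in Z.
Proof.
move=> AZ Z1.
have [x xA] : exists x : {perm T}, forall a, a \in A -> x a \in Z.
  elim: {A}_.+1 {-2}A (ltnSn #|A :\: Z|) AZ => // n IH A; rewrite ltnS => cA AZ.
  have [AZ0|[a aAZ]] := set_0Vmem (A :\: Z).
    by exists 1%g => a aA; rewrite perm1 (subsetP _ _ aA) // -setD_eq0 AZ0.
  have /set0Pn[z zZA] : Z :\: A != set0.
    apply: contraTneq AZ => /eqP; rewrite setD_eq0 => ZA.
    rewrite -ltnNge proper_card // properE ZA; apply/subsetPn; exists a;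
    by move: aAZ; rewrite inE => /andP[].
  move: (aAZ) zZA; rewrite !inE => /andP[aZ aA] /andP[zA zZ].
  pose A' := z |: (A :\ a).
  have cA' : #|A'| = #|A| by rewrite /A' cardsU1 !inE (negPf zA) andbF [RHS](cardsD1 a) aA.
  have [||x xA'] := IH A'.
  - apply: leq_trans cA; apply: proper_card; rewrite properE; apply/andP; split.
      apply/subsetP => w; rewrite !inE => /andP[wZ /orP[/eqP wz|/andP[_ ->]]]; last by rewrite wZ.
      by rewrite wz zZ in wZ.
    apply/subsetPn; exists a => //; rewrite !inE eqxx /= orbF negb_and.
    by apply/orP; right; apply: contraNneq zA => <-.
  - by rewrite cA'.
  exists (tperm a z * x)%g => w wA; rewrite permM.
  have [->|wa] := eqVneq w a; first by rewrite tpermL xA' // !inE eqxx.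
  have wz : w != z by apply: contraNneq zA => <-.
  by rewrite tpermD 1?eq_sym // xA' // !inE wa wA orbT.
have [ex|ex] := boolP (x : bool); last by exists x; rewrite ?(negPf ex).
have /card_gt1P[z1 [z2 [z1Z z2Z z12]]] := Z1.
exists (x * tperm z1 z2)%g => [|a /xA xaZ]; first by rewrite odd_permM odd_tperm ex z12.
by rewrite permM; case: tpermP.
Qed.

End SetMapping.

Section CubeRoot.
Variable F : numClosedFieldType.

Lemma cube_root_exists : exists w : F, [/\ w != 1, w ^+ 3 = 1 & w ^+ 2 + w + 1 = 0].
Proof.
pose w : F := (-1 + sqrtC (- 3%:R)) / 2%:R.
have s3 : sqrtC (- 3%:R) ^+ 2 = - 3%:R :> F by rewrite sqrtCK.
have w2 : w ^+ 2 + w + 1 = 0.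
  have -> : w ^+ 2 + w + 1 = (sqrtC (- 3%:R) ^+ 2 + 3%:R) / 4%:R.
    by rewrite /w; field.
  by rewrite s3 addNr mul0r.
exists w; split=> //.
  apply/eqP => w1; move: w2; rewrite w1 expr1n => /eqP.
  by rewrite -(natrD _ 1 1) -(natrD _ 2 1) pnatr_eq0.
have : (w ^+ 2 + w + 1) * (w - 1) = 0 by rewrite w2 mul0r.
by move/eqP; rewrite (_ : _ * _ = w ^+ 3 - 1) ?subr_eq0 => [/eqP|]; last ring.
Qed.

End CubeRoot.

Section Level.
Variables (F : numClosedFieldType) (T : finType) (d : nat) (r : {perm T} -> 'M[F]_d).
Hypothesis r1 : r 1%g = 1%:M.
Hypothesis rM : forall s t : {perm T}, s = false :> bool -> t = false :> bool ->
  r (s * t)%g = r s *m r t.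

(* Either all 3-cycles of [X] act trivially, or one of them has a pair of
   swapped, hence equidimensional, eigenspaces: each is a representation of
   the alternating group of the remaining points, of at most half the dimension. *)
Lemma level_alt (X : {set T}) (U : 'M[F]_d) : U != 0 ->
    (forall s : {perm T}, s = false :> bool -> perm_on X s -> stablemx U (r s)) ->
  exists (Y : {set T}) (k : nat) (v : 'rV[F]_d),
    [/\ (#|X| <= #|Y| + (3 * k + 4))%N, (2 ^ k <= \rank U)%N, v != 0, (v <= U)%MS
      & forall s : {perm T}, s = false :> bool -> perm_on Y s -> v *m r s = v].
Proof.
have [w [w1 w3 w210]] := cube_root_exists F.
elim: {X}_.+1 {-2}X (ltnSn #|X|) U => // n IH X; rewrite ltnS => cX U U0 stU.
have rU : (0 < \rank U)%N by rewrite lt0n mxrank_eq0.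
have [v0 v0U v00] : exists2 v : 'rV[F]_d, (v <= U)%MS & v != 0 by apply/rowV0Pn.
have [X4|X5] := leqP #|X| 4.
  exists set0, 0%N, v0; split=> //; first by rewrite cards0.
  move=> s _ s0; suff -> : s = 1%g by rewrite r1 mulmx1.
  by apply/permP => x; rewrite perm1 (out_perm s0) ?inE.
pose triv (s : {perm T}) := s = false :> bool /\ forall u : 'rV[F]_d, (u <= U)%MS -> u *m r s = u.
have [all_triv|[x [y [z [xX yX zX uxyz ntriv]]]]] : 
    (forall x y z, x \in X -> y \in X -> z \in X -> uniq [:: x; y; z] -> triv (tri x y z)) \/
    exists x y z, [/\ x \in X, y \in X, z \in X, uniq [:: x; y; z] & ~ triv (tri x y z)].
- have [h|h] := pselect (exists x y z, [/\ x \in X, y \in X, z \in X, uniq [:: x; y; z] & ~ triv (tri x y z)]).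
    by right.
  left=> x y z xX yX zX u; apply: contrapT => nt; apply: h.
  by exists x, y, z.
- have /card_gt1P[a [b [aX bX ab]]] : (1 < #|X|)%N by apply: leq_trans X5.
  exists X, 0%N, v0; split=> //; first exact: leq_addr.
  suff H s : perm_on X s -> s = false :> bool -> triv s.
    by move=> s es sX; have [_] := H s sX es; apply.
  apply: (alt_gen aX bX ab).
  + by split=> [|u _]; rewrite ?odd_perm1 // r1 mulmx1.
  + move=> s1 s2 [e1 h1] [e2 h2]; split=> [|u uU]; first by rewrite odd_permM e1 e2.
    by rewrite rM // mulmxA h1 // h2.
  + move=> s1 [e1 h1]; split=> [|u uU]; first by rewrite odd_permV.
    rewrite -{1}[u]h1 // -mulmxA -rM ?odd_permV // mulgV r1 mulmx1 //.
  + move=> c cX' ca cb; apply: all_triv => //.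
    by rewrite /= !inE negb_or ab ![_ == c]eq_sym ca cb.
have ec := tri_even uxyz; set c := tri x y z in ntriv ec.
have stC : stablemx U (r c) by apply: stU => //; apply: tri_on.
have C3 : r c *m r c *m r c = 1%:M.
  have ecc : (c * c)%g = false :> bool by rewrite odd_permM ec.
  by rewrite -(rM ec ec) -(rM ecc ec) tri_cube.
have [u uU uC] : exists2 u : 'rV[F]_d, (u <= U)%MS & u *m r c != u.
  apply: contrapT => h; apply: ntriv; split=> // u uU; apply: contrapT => /eqP uC.
  by apply: h; exists u.
have CU (v : 'rV[F]_d) : (v <= U)%MS -> (v *m r c <= U)%MS.
  by move=> vU; apply: submx_trans stC; apply: submxMr.
have [l [l1 l3 [v [vU v0' vC]]]] : exists l : F, [/\ l != 1, l ^+ 3 = 1 &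
    exists v : 'rV[F]_d, [/\ (v <= U)%MS, v != 0 & v *m r c = l *: v]].
  (* On the image of [c - 1] one has [(c - w) (c - w^2) = c^2 + c + 1 = 0], so either [u1] or its
     image under [c - w] is an eigenvector with eigenvalue different from 1. *)
  pose u1 := u *m r c - u.
  have u1U : (u1 <= U)%MS by rewrite addmx_sub ?CU // -scaleN1r scalemx_sub.
  have u10 : u1 != 0 by rewrite subr_eq0.
  have [u2|u2] := eqVneq (u1 *m r c) (w *: u1); first by exists w; split=> //; exists u1.
  exists (w ^+ 2); split; first 2 last.
  - exists (u1 *m r c - w *: u1); split.
    + by rewrite addmx_sub ?CU // -scaleNr scalemx_sub.
    + by rewrite subr_eq0.
    + have e2 : u1 *m r c *m r c = - (u1 *m r c) - u1.
        have e3 : u *m r c *m r c *m r c = u by rewrite -[RHS]mulmx1 -C3 !mulmxA.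
        rewrite /u1 !mulmxBl e3 !opprB; apply/rowP => i.
        by move: (u *m r c *m r c) (u *m r c) => p q; rewrite !mxE; ring.
      have gen (p q : 'rV[F]_d) : - p - q - w *: p = w ^+ 2 *: (p - w *: q).
        apply/rowP => i; rewrite !mxE; move: (p 0 i) (q 0 i) => a b.
        apply/eqP; rewrite -subr_eq0; apply/eqP.
        transitivity (- ((w ^+ 2 + w + 1) * a) + (w ^+ 3 - 1) * b); first ring.
        by rewrite w210 w3 subrr !mul0r oppr0 addr0.
      by rewrite mulmxBl -scalemxAl e2 gen.
  - by apply: contraNneq w1 => w2; rewrite -[X in _ == X]w3 exprS w2 mulr1.
  - by rewrite -exprM mulnC exprM w3 expr1n.
have l0 : l != 0 by apply: contra_eq_neq l3 => ->; rewrite expr0n /= eq_sym oner_eq0.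
have ll : l != l^-1.
  apply: contraNneq l1 => e; rewrite -[X in _ == X]l3.
  by rewrite exprS expr2 {3}e mulVf ?mulr1.
have [a [b [aX bX ab anin bnin]]] : exists a b, [/\ a \in X, b \in X, a != b,
    a \notin [:: x; y; z] & b \notin [:: x; y; z]].
  have /card_gt1P[a [b [+ + ab]]] : (1 < #|X :\: [set x; y; z]|)%N.
    rewrite cardsD; have : (#|X :&: [set x; y; z]| <= 3)%N.
      apply: leq_trans (subset_leq_card (subsetIr _ _)) _.
      apply: leq_trans (leq_card_setU _ _) _; rewrite cards1 cards2.
      by case: (_ != _).
    by move=> h; apply: (leq_sub X5 h).
  rewrite !inE => /andP[h1 aX] /andP[h2 bX]; exists a, b; split=> //; rewrite !inE.
    by move: h1; rewrite -!orbA.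
  by move: h2; rewrite -!orbA.
have txy : x != y by move: uxyz; rewrite /= !inE negb_or => /andP[/andP[]].
(* The transposition of [x] and [y] inverts the 3-cycle; the second one, disjoint from it, makes [t]
   even. So [t] exchanges the eigenspaces of [l] and [l^-1]. *)
pose t := (tperm x y * tperm a b)%g.
have et : t = false :> bool by rewrite odd_permM !odd_tperm txy ab.
have tt : (t * t)%g = 1%g.
  have comm : (tperm x y * tperm a b = tperm a b * tperm x y)%g.
    move: anin bnin; rewrite !inE !negb_or => /and3P[ax ay _] /and3P[bx by_ _].
    rewrite -[RHS](mulKVg (tperm x y)) -[(_^-1 * _)%g]/((_ ^ _)%g) tpermJ.
    by rewrite !tpermD // eq_sym.
  by rewrite /t {1}comm mulgA -[(_ * _ * tperm x y)%g]mulgA tperm2 mulg1 tperm2.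
have tX : perm_on X t by apply: perm_onM; apply/subsetP => q; rewrite !inE;
  apply: contraR => qX; rewrite tpermD //; apply: contraNneq qX => <-.
have tV : t^-1%g = t by apply/eqP; rewrite eq_invg_mul tt.
have tct : (t * c * t = c^-1)%g.
  move: (anin) (bnin); rewrite !inE !negb_or => /and3P[ax ay az] /and3P[bx by_ bz].
  move: uxyz; rewrite /= !inE negb_or !andbT => /andP[/andP[xy xz] yz].
  have tx : t x = y by rewrite permM tpermL tpermD.
  have ty : t y = x by rewrite permM tpermR tpermD.
  have tz : t z = z by rewrite permM !tpermD.
  rewrite -{1}tV -mulgA -conjgE triJ tx ty tz /c /tri invMg !tpermV.
  rewrite -[RHS](mulKVg (tperm x y)) [tperm y x]tpermC; congr (_ * _)%g.
  by rewrite -conjgE tpermJ tpermL tpermD // eq_sym.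
pose E m := (U :&: eigenspace (r c) m)%MS.
have EP m (p : 'rV[F]_d) : reflect ((p <= U)%MS /\ p *m r c = m *: p) (p <= E m)%MS.
  rewrite sub_capmx; apply: (iffP andP) => -[h1]; last by move/eigenspaceP.
  by move/eigenspaceP.
have E_rt m : m != 0 -> (E m *m r t <= E m^-1)%MS.
  move=> m0; apply/row_subP => i; rewrite row_mul.
  have /EP[pU pC] : (row i (E m) <= E m)%MS by apply: row_sub.
  move: (row i (E m)) pU pC => p pU pC; apply/EP; split.
    by apply: submx_trans (stU _ et tX); apply: submxMr.
  have ecV : c^-1%g = false :> bool by rewrite odd_permV.
  have pCV : p *m r c^-1%g = m^-1 *: p.
    rewrite -{2}[p]mulmx1 -r1 -(mulgV c) rM // mulmxA pC -scalemxAl scalerA mulVf //.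
    by rewrite scale1r.
  have tc : (t * c = c^-1 * t)%g by rewrite -tct -(mulgA (t * c)%g) tt mulg1.
  by rewrite -mulmxA -rM // tc rM // mulmxA pCV -scalemxAl.
have rt_free : row_free (r t).
  have rtt : r t *m r t = 1%:M by rewrite -rM // tt.
  by rewrite row_free_unit; case: (mulmx1_unit rtt).
have El0 : E l != 0.
  apply: contraNneq v0' => E0; have : (v <= E l)%MS by apply/EP.
  by rewrite E0 submx0.
have cap0 : (E l :&: E l *m r t = 0)%MS.
  apply/eqP; rewrite -submx0; apply/rV_subP => p.
  rewrite sub_capmx => /andP[/EP[_ e1] /submx_trans/(_ (E_rt _ l0))/EP[_ e2]].
  move: e2; rewrite e1 => /eqP; rewrite -subr_eq0 -scalerBl scaler_eq0 subr_eq0 (negPf ll) /=.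
  by rewrite submx0.
have rank2 : (2 * \rank (E l) <= \rank U)%N.
  rewrite mul2n -addnn -{2}(mxrankMfree (E l) rt_free) -mxrank_disjoint_sum //.
  apply: mxrankS; rewrite addsmx_sub capmxSl /=.
  by apply: submx_trans (stU _ et tX); apply: submxMr; apply: capmxSl.
(* Permutations of [X'] commute with the 3-cycle and preserve its eigenspaces. Each halving of the
   rank thus costs three points, which with the at most four points of the base case makes
   [3 * k + 4]. *)
pose X' := X :\: [set x; y; z].
have cX' : (#|X'| < #|X|)%N.
  apply: proper_card; rewrite properE subsetDl; apply/subsetPn; exists x => //.
  by rewrite !inE eqxx.
have X'3 : (#|X| <= #|X'| + 3)%N.
  rewrite -(cardsID [set x; y; z] X) addnC leq_add2l.
  apply: leq_trans (subset_leq_card (subsetIr _ _)) _.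
  apply: leq_trans (leq_card_setU _ _) _; rewrite cards1 cards2.
  by case: (_ != _).
have stE (s : {perm T}) : s = false :> bool -> perm_on X' s -> stablemx (E l) (r s).
  move=> es sX'; have sX : perm_on X s by apply: subset_trans sX' (subsetDl _ _).
  rewrite sub_capmx; apply/andP; split.
    by apply: submx_trans (stU _ es sX); apply: submxMr; apply: capmxSl.
  apply: submx_trans (submxMr _ (capmxSr _ _)) _.
  apply: comm_mx_stable_eigenspace; rewrite /comm_mx -!rM //; congr (r _).
  have fix_s q : q \in [:: x; y; z] -> s q = q.
    by move=> qin; rewrite (out_perm sX') // !inE -orbA; move: qin; rewrite !inE => ->.
  by rewrite conjgC triJ !fix_s // !inE eqxx ?orbT.
have [Y [k [q [q1 q2 q3 q4 q5]]]] := IH X' (leq_trans cX' cX) (E l) El0 stE.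
exists Y, k.+1, q; split=> //.
- apply: leq_trans X'3 _; apply: leq_trans (leq_add q1 (leqnn 3)) _.
  by clear; lia.
- by rewrite expnS; apply: leq_trans rank2; rewrite leq_mul2l q2 orbT.
- exact: submx_trans q4 (capmxSl _ _).
Qed.

End Level.

Section LevelFixed.
Variables (F : numClosedFieldType) (T : finType) (d : nat) (r : {perm T} -> 'M[F]_d).
Hypothesis r1 : r 1%g = 1%:M.
Hypothesis rM : forall s t : {perm T}, s = false :> bool -> t = false :> bool ->
  r (s * t)%g = r s *m r t.
Variable Z : {set T}.
Hypothesis Z1 : (1 < #|Z|)%N.
Variable U : 'M[F]_d.
(** The second alternative is for alphabets too small to contain a [Z] of the wanted size; the
    pointwise stabilizer is then trivial. *)
Hypothesis ZU : (forall k, (2 ^ k <= \rank U)%N -> (3 * k + 4 <= #|Z|)%N) \/ Z = [set: T].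

(** The set [Y] from [level_alt] is not under control, only its size is. An even permutation moving
    the complement of [Y] into [Z] carries the fixed vector to one for the prescribed stabilizer. *)
Lemma level_fixed : U != 0 ->
    (forall s : {perm T}, s = false :> bool -> stablemx U (r s)) ->
  exists v : 'rV[F]_d, [/\ v != 0, (v <= U)%MS
    & forall s : {perm T}, s = false :> bool -> perm_on (~: Z) s -> v *m r s = v].
Proof.
move=> U0 stU; case: ZU => [hZ|ZT]; last first.
  have /rowV0Pn[v vU v0] := U0; exists v; split=> // s _ sZ.
  suff -> : s = 1%g by rewrite r1 mulmx1.
  by apply/permP => x; rewrite perm1 (out_perm sZ) // ZT !inE.
have [Y [k [v [cY /hZ kZ v0 vU vY]]]] := level_alt r1 rM (X := [set: T]) U0 (fun s es _ => stU s es).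
have [x ex xZ] : exists2 x : {perm T}, x = false :> bool & forall a, a \in ~: Y -> x a \in Z.
  apply: perm_into => //; apply: leq_trans kZ.
  by rewrite -(leq_add2l #|Y|) cardsC -cardsT.
exists (v *m r x); split.
- apply: contraNneq v0 => vx; have exV : x^-1%g = false :> bool by rewrite odd_permV.
  by rewrite -[v]mulmx1 -r1 -(mulgV x) rM // mulmxA vx mul0mx.
- by apply: submx_trans (stU x ex); apply: submxMr.
move=> s es sZ.
have exV : x^-1%g = false :> bool by rewrite odd_permV.
have esx : (s ^ x^-1)%g = false :> bool by rewrite conjgE !odd_permM invgK exV ex es.
have -> : v *m r x *m r s = v *m r (s ^ x^-1)%g *m r x.
  rewrite -mulmxA -rM // -[RHS]mulmxA -rM // conjgE invgK -!mulgA mulVg mulg1 //.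
rewrite vY //; apply/subsetP => y; rewrite inE; apply: contraR => yY.
rewrite -{1}[y](permK x) permJ (out_perm sZ) ?permK ?inE ?negbK ?xZ ?inE //.
Qed.

End LevelFixed.

(** * Powers of an alternating group: fixed vectors and double coset keys *)

Section PowerOfAlt.
Variables (V T : finType).

Definition alt_type : finGroupType := [subg 'Alt_T].
Definition alt_power : finGroupType := {dffun forall _ : V, alt_type}.
Implicit Types (a : alt_power) (s t : {perm T}).

Definition to_alt s : alt_type := subg 'Alt_T s.

Lemma to_altK s : s = false :> bool -> val (to_alt s) = s.
Proof. by move=> es; rewrite subgK // Alt_even es. Qed.

Lemma alt_typeP (a : alt_type) : val a = false :> bool.
Proof. by apply/negbTE; rewrite -Alt_even subgP. Qed.

Lemma to_altM s t : s = false :> bool -> t = false :> bool ->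
  to_alt (s * t)%g = (to_alt s * to_alt t)%g.
Proof. by move=> es et; rewrite /to_alt subgM // Alt_even ?es ?et. Qed.

Lemma val_altM (a b : alt_type) : val (a * b)%g = (val a * val b)%g. Proof. by []. Qed.

Definition at_coord (j : V) (a : alt_type) : alt_power := [ffun i => if i == j then a else 1%g].

Lemma at_coordE j (a : alt_type) i : at_coord j a i = if i == j then a else 1%g.
Proof. by rewrite ffunE. Qed.

Lemma at_coordM j : {morph at_coord j : a b / (a * b)%g}.
Proof.
by move=> a b; apply/ffunP => i; rewrite mulg_ffun !at_coordE; case: eqP; rewrite ?mulg1.
Qed.

Lemma at_coord1 j : at_coord j 1%g = 1%g.
Proof. by apply/ffunP => i; rewrite at_coordE oneg_ffun; case: eqP. Qed.

Lemma at_coordC i j (a b : alt_type) : i != j -> (at_coord i a * at_coord j b = at_coord j b * at_coord i a)%g.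
Proof.
move=> ij; apply/ffunP => k; rewrite !mulg_ffun !at_coordE.
by have [->|ki] := eqVneq k i; rewrite ?(negPf ij) ?mulg1 ?mul1g.
Qed.

Lemma alt_power_ind (P : alt_power -> Prop) a :
    P 1%g -> (forall x y, P x -> P y -> P (x * y)%g) -> (forall j, P (at_coord j (a j))) -> P a.
Proof.
move=> P1 PM Pj.
pose f (S : seq V) : alt_power := [ffun i => if i \in S then a i else 1%g].
have Pf S : uniq S -> P (f S).
  elim: S => [_|j S IH /= /andP[jS uS]].
    by rewrite (_ : f [::] = 1%g) //; apply/ffunP => i; rewrite ffunE oneg_ffun.
  rewrite (_ : f (j :: S) = (at_coord j (a j) * f S)%g); first by apply: PM => //; apply: IH.
  apply/ffunP => i; rewrite mulg_ffun at_coordE !ffunE inE.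
  by have [->|ij] := eqVneq i j; rewrite /= ?(negPf jS) ?mulg1 ?mul1g.
have -> : a = f (enum V) by apply/ffunP => i; rewrite ffunE mem_enum.
exact/Pf/enum_uniq.
Qed.

Variable Z : {set T}.

Definition fix_power := [set a : alt_power | [forall j, perm_on (~: Z) (val (a j))]].

Lemma fix_powerP a : reflect (forall j, perm_on (~: Z) (val (a j))) (a \in fix_power).
Proof. by rewrite inE; apply: forallP. Qed.

Lemma fix_power_group : group_set fix_power.
Proof.
apply/group_setP; split=> [|a b /fix_powerP ha /fix_powerP hb]; apply/fix_powerP => j.
  by rewrite oneg_ffun; apply: perm_on1.
by rewrite mulg_ffun; apply: (perm_onM (ha j) (hb j)).
Qed.
Canonical fix_power_Group := Group fix_power_group.

Section Fixed.
Variables (F : numClosedFieldType) (N n : nat) (q : alt_power -> 'M[F]_n).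
Hypothesis rep : is_repr q.
Hypothesis nN : (0 < n <= N)%N.
Hypothesis Z1 : (1 < #|Z|)%N.
Hypothesis ZN : (forall k, (2 ^ k <= N)%N -> (3 * k + 4 <= #|Z|)%N) \/ Z = [set: T].

(** Coordinates are treated one by one. As they commute, the vectors fixed by the earlier ones form
    a subspace stable under the next, of rank at most [N], and [level_fixed] applies inside it. *)
Lemma alt_power_fixed : exists2 v : 'rV[F]_n, v != 0 &
  forall h, h \in fix_power -> v *m q h = v.
Proof.
case: rep => q1 qM.
pose r j s := q (at_coord j (to_alt s)).
have r1 j : r j 1%g = 1%:M.
  rewrite /r (_ : to_alt 1%g = 1%g) ?at_coord1 //; apply: val_inj.
  by rewrite to_altK ?odd_perm1.
have rM j (s t : {perm T}) : s = false :> bool -> t = false :> bool -> r j (s * t)%g = r j s *m r j t.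
  by move=> es et; rewrite /r to_altM // at_coordM qM.
pose fixed (S : seq V) (v : 'rV[F]_n) := forall j (s : {perm T}), j \in S -> s = false :> bool ->
  perm_on (~: Z) s -> v *m r j s = v.
have fixed0 S : fixed S 0 by move=> j s _ _ _; rewrite mul0mx.
have fixedL S (c : F) u v : fixed S u -> fixed S v -> fixed S (c *: u + v).
  by move=> hu hv j s jS es sZ; rewrite mulmxDl -scalemxAl hu // hv.
have ex S : uniq S -> exists2 v, v != 0 & fixed S v.
  elim: S => [_|j S IH /= /andP[jS uS]].
    case/andP: nN => n0 _; exists (delta_mx 0 (Ordinal n0)) => //.
    apply/eqP => /rowP/(_ (Ordinal n0)); rewrite !mxE !eqxx => /eqP.
    by rewrite oner_eq0.
  have [v0 v00 v0S] := IH uS.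
  have [U UP] := subspace_of_pred (fixed0 S) (fixedL S).
  have U0 : U != 0 by apply: contraNneq v00 => U0; move/UP: v0S; rewrite U0 submx0.
  have stU (s : {perm T}) : s = false :> bool -> stablemx U (r j s).
    move=> es; apply/row_subP => i; rewrite row_mul; apply/UP.
    have /UP hi : (row i U <= U)%MS by apply: row_sub.
    move=> k t kS et tZ; rewrite -mulmxA -qM at_coordC; last by apply: contraNneq jS => ->.
    by rewrite qM mulmxA hi.
  have [|v [v0' /UP vS vj]] := level_fixed (r1 j) (rM j) Z1 _ U0 stU.
    case: ZN => [h|]; last by right.
    left=> k hk; apply: h; apply: leq_trans hk _; apply: leq_trans (rank_leq_row _) _.
    by case/andP: nN.
  exists v => // k s; rewrite inE => /orP[/eqP ->|kS]; [exact: vj | exact: vS].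
have [v v0 vS] := ex _ (enum_uniq V).
exists v => // h /fix_powerP hZ; apply: (alt_power_ind (P := fun h => v *m q h = v)).
- by rewrite q1 mulmx1.
- by move=> x y hx hy; rewrite qM mulmxA hx.
- move=> j; have := vS j (val (h j)); rewrite /r mem_enum alt_typeP.
  rewrite (_ : to_alt (val (h j)) = h j); first by apply.
  by apply: val_inj; rewrite to_altK // alt_typeP.
Qed.

End Fixed.

Variable u : nat.
Hypotheses (u_gt0 : (0 < u)%N) (cZ : (#|Z| <= u * u)%N).

Lemma alt_power_key : exists key : alt_power -> {ffun V -> coset_key u},
  forall g g', key g = key g' ->
  exists h x h', [/\ h \in fix_power, x \in 'N(fix_power)%g, h' \in fix_power
    & g' = (h * g ^ x * h')%g].
Proof.
have [key keyP] := coset_key_exists u_gt0 cZ.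
exists (fun g : alt_power => [ffun j => key (val (g j))]) => g g' /ffunP e.
have tr j : exists t : {perm T} * {perm T} * {perm T},
    [/\ perm_on (~: Z) t.1.1, perm_on Z t.1.2, perm_on (~: Z) t.2
      & val (g' j) = (t.1.1 * val (g j) ^ t.1.2 * t.2)%g]
    /\ [/\ t.1.1 = false :> bool, t.1.2 = false :> bool & t.2 = false :> bool].
  have [|k [x [h [hk hx hh -> [? ? ?]]]]] := keyP (val (g j)) (val (g' j)).
    by have := e j; rewrite !ffunE.
  by exists (k, x, h); split.
have [t tP] := choice tr.
pose h : alt_power := [ffun j => to_alt (t j).1.1].
pose x : alt_power := [ffun j => to_alt (t j).1.2].
pose h' : alt_power := [ffun j => to_alt (t j).2].
exists h, x, h'; split.
- by apply/fix_powerP => j; have [[? ? ? ?] [? ? ?]] := tP j; rewrite ffunE to_altK.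
(* The coordinates of [x] live on [Z] and those of the subgroup off [Z], so [x] even centralizes
   it. *)
- apply: (subsetP (cent_sub _)); apply/centP => y /fix_powerP yZ.
  apply/ffunP => j; rewrite !mulg_ffun; apply: val_inj; rewrite !val_altM ffunE.
  have [[_ xZ _ _] [_ ex _]] := tP j; rewrite to_altK //.
  by apply: (@perm_onC _ Z (~: Z)) => //; rewrite -setI_eq0 setICr.
- by apply/fix_powerP => j; have [[? ? ? ?] [? ? ?]] := tP j; rewrite ffunE to_altK.
- apply/ffunP => j; rewrite !mulg_ffun invg_ffun; apply: val_inj.
  have [[_ _ _ ->] [? ? ?]] := tP j; rewrite conjgE !val_altM !ffunE /= !to_altK //.
Qed.

Lemma card_alt_power_key : #|{ffun V -> coset_key u}| = ((8 * (u * u).+1 ^ (4 * u)) ^ #|V|)%N.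
Proof. by rewrite card_ffun card_coset_key. Qed.

End PowerOfAlt.

Lemma lt_block (m j k : nat) : (j < m -> k < 3 -> 3 * j + k < 3 * m)%N.
Proof. lia. Qed.

Lemma block_inj (j k j' k' : nat) : (k < 3)%N -> (k' < 3)%N ->
  (3 * j + k = 3 * j' + k')%N -> j = j' /\ k = k'.
Proof. lia. Qed.

(** * Triviality of low-dimensional representations of large alternating groups *)

Section SmallRepresentations.
Variable F : numClosedFieldType.

Lemma cube_root_diagonalizable n (f : 'M[F]_n.+1) : f *m f *m f = 1%:M -> diagonalizable f.
Proof.
move=> f3; have [w [w1 w3 w210]] := cube_root_exists F.
have w0 : w != 0 by apply: contra_eq_neq w3 => ->; rewrite expr0n /= eq_sym oner_eq0.
apply/diagonalizableP; exists [:: 1; w; w ^+ 2].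
  rewrite /= !inE negb_or !andbT ![1 == _]eq_sym w1 /=; apply/andP; split.
    by apply: contraNneq w1 => w2; rewrite -[X in _ == X]w3 exprS w2 mulr1.
  by rewrite -subr_eq0 expr2 -{1}[w]mulr1 -mulrBr mulf_eq0 negb_or w0 subr_eq0 eq_sym w1.
rewrite !big_cons big_nil mulr1; apply: mxminpoly_min.
have -> : ('X - 1%:P) * (('X - w%:P) * ('X - (w ^+ 2)%:P)) = 'X^3 - 1 :> {poly F}.
  have e1 : (w ^+ 2)%:P = - w%:P - 1 :> {poly F}.
    rewrite -polyCN -polyC1 -polyCB; congr (_%:P).
    by apply/eqP; rewrite -subr_eq0 !opprD !opprK addrA w210.
  have e2 : w%:P * w%:P + w%:P + 1 = 0 :> {poly F}.
    by rewrite -polyCM -polyC1 -!polyCD -expr2 w210 polyC0.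
  transitivity ('X^3 - 1 - ('X - 1) * (w%:P * w%:P + w%:P + 1) : {poly F}).
    by rewrite e1 polyC1; ring.
  by rewrite e2 mulr0 subr0.
have f3' : f * f * f = 1 := f3.
by rewrite rmorphB rmorphXn rmorph1 /= horner_mx_X !exprS expr0 mulr1 mulrA f3' subrr.
Qed.

Variables (d : nat) (T : finType) (r : {perm T} -> 'M[F]_d).
Hypothesis r1 : r 1%g = 1%:M.
Hypothesis rM : forall s t : {perm T}, s = false :> bool -> t = false :> bool ->
  r (s * t)%g = r s *m r t.
(** Room for [3 ^ d + 1] disjoint 3-cycles, one more than there are diagonal matrices of size [d]
    whose entries are cube roots of unity. *)
Hypothesis cT : (3 * (3 ^ d).+1 <= #|T|)%N.

Let pt (k : nat) (hk : (k < 3 * (3 ^ d).+1)%N) : T := enum_val (Ordinal (leq_trans hk cT)).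

Lemma pt_inj k k' hk hk' : @pt k hk = @pt k' hk' -> k = k'.
Proof. by move=> /enum_val_inj[]. Qed.

Lemma three_cycles : exists c : 'I_(3 ^ d).+1 -> {perm T},
  [/\ injective c, forall i, c i = false :> bool,
      forall i, (c i * c i * c i = 1)%g & forall i j, (c i * c j = c j * c i)%g].
Proof.
have lt3 (j : 'I_(3 ^ d).+1) k : (k < 3)%N -> (3 * j + k < 3 * (3 ^ d).+1)%N.
  by move=> k3; apply: lt_block.
pose p j k (hk : (k < 3)%N) := pt (lt3 j k hk).
have p_inj j k hk j' k' hk' : p j k hk = p j' k' hk' -> j = j' /\ k = k'.
  move=> /pt_inj e; suff [e1 e2] : (j : nat) = j' /\ k = k' by split=> //; apply: val_inj.
  exact: block_inj e.
pose p0 j := p j 0%N isT; pose p1 j := p j 1%N isT; pose p2 j := p j 2%N isT.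
have u j : uniq [:: p0 j; p1 j; p2 j].
  rewrite /= !inE negb_or !andbT; apply/andP; split; first (apply/andP; split);
  by apply/eqP => /p_inj[].
have out i j k hk : i != j -> p i k hk \notin [:: p0 j; p1 j; p2 j].
  by move=> ij; rewrite !inE !negb_or; apply/and3P; split;
     apply: contraNneq ij => /p_inj[-> _].
exists (fun j => tri (p0 j) (p1 j) (p2 j)); split.
- move=> i j e; apply: contrapT => /eqP ij; have [e1 _ _] := triE (u i).
  have := congr1 (fun s : {perm T} => s (p0 i)) e; rewrite /= e1 tri_out ?out //.
  by move=> /p_inj[_].
- by move=> j; apply: tri_even.
- by move=> j; apply: tri_cube.
- move=> i j; have [->//|ij] := eqVneq i j.
  by rewrite [LHS]conjgC triJ !tri_out // out // eq_sym.
Qed.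

(** Disjoint 3-cycles commute, so their images are simultaneously diagonal with cube roots of unity
    as entries. By the pigeonhole principle two images coincide. *)
Lemma small_repr_trivial_on_some : exists2 s : {perm T},
  s != 1%g & s = false :> bool /\ r s = 1%:M.
Proof.
have [c [c_inj ec c3 cC]] := three_cycles.
have [w [w1 w3 w210]] := cube_root_exists F.
suff [i [j [ij rij]]] : exists i j, i != j /\ r (c i) = r (c j).
  exists ((c i)^-1 * c j)%g; first by rewrite -eq_mulVg1 (inj_eq c_inj).
  rewrite odd_permM odd_permV !ec; split=> //.
  by rewrite rM ?odd_permV // -rij -rM ?odd_permV // mulVg.
case: d r r1 rM c c_inj ec c3 cC => [|d'] q q1 qM c c_inj ec c3 cC.
  by exists ord0, ord_max; split=> //; apply/matrixP => -[].
have [] := (codiagonalizableP [seq q (c i) | i <- enum 'I_(3 ^ d'.+1).+1]).1.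
  split=> [f g /mapP[i _ ->] /mapP[j _ ->]|f /mapP[i _ ->]].
    by rewrite /comm_mx -!qM // cC.
  by apply: cube_root_diagonalizable; rewrite -!qM ?odd_permM ?ec // c3.
move=> P Pu /allP Pdiag.
have dg i : exists v : 'rV[F]_d'.+1, P *m q (c i) *m invmx P = diag_mx v.
  have /Pdiag /= /similar_diagPex[v /eqP h] : q (c i) \in [seq q (c i) | i <- enum 'I_(3 ^ d'.+1).+1].
    by apply: map_f; rewrite mem_enum.
  by exists v; rewrite -h conjumx.
have [v vP] := choice dg.
have v3 i k : (v i 0 k) ^+ 3 = 1.
  have : diag_mx (v i) *m diag_mx (v i) *m diag_mx (v i) = 1%:M.
    rewrite -!vP !mulmxA !mulmxKV // -[P *m _ *m _]mulmxA -[P *m _ *m _]mulmxA.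
    by rewrite -!qM ?odd_permM ?ec // c3 q1 mulmx1 mulmxV.
  rewrite !mulmx_diag => /matrixP/(_ k k).
  by rewrite !mxE !eqxx !mulr1n => <-; rewrite !exprS expr0 mulr1 mulrA.
have root3 x : x ^+ 3 = 1 -> exists k : 'I_3, x = w ^+ k.
  move=> x3; have : (x - 1) * ((x - w) * (x - w ^+ 2)) = 0.
    transitivity ((x - 1) * (x ^+ 2 - (w ^+ 2 + w + 1) * x + x + w ^+ 3)); first ring.
    by rewrite w210 w3 -[RHS](subrr 1) -[X in _ = X - _]x3; ring.
  move/eqP; rewrite !mulf_eq0 !subr_eq0 => /or3P[]/eqP ->.
  - by exists (@Ordinal 3 0 isT).
  - by exists (@Ordinal 3 1 isT).
  - by exists (@Ordinal 3 2 isT).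
have [t tP] := choice (fun ik : 'I_(3 ^ d'.+1).+1 * 'I_d'.+1 => root3 _ (v3 ik.1 ik.2)).
pose f i : {ffun 'I_d'.+1 -> 'I_3} := [ffun k => t (i, k)].
have /injectivePn[i [j ij fij]] : ~~ injectiveb f.
  apply/negP => /injectiveP/leq_card.
  by rewrite card_ffun !card_ord ltnn.
exists i, j; split; first by [].
have vij : v i = v j.
  apply/rowP => k; have := congr1 (fun g : {ffun _} => g k) fij; rewrite /f !ffunE => e.
  by rewrite (tP (i, k)) (tP (j, k)) e.
have := congr1 (fun A => invmx P *m A *m P) (etrans (vP i) (etrans (congr1 (@diag_mx _ _) vij) (esym (vP j)))).
by rewrite !mulmxA !mulmxKV // !mulVmx // !mul1mx.
Qed.

(** The kernel among even permutations is a nontrivial normal subgroup of a simple group. *)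
Theorem small_repr_trivial : (4 < #|T|)%N ->
  forall s : {perm T}, s = false :> bool -> r s = 1%:M.
Proof.
move=> T5 s es.
pose ker := [set s : {perm T} | ~~ s & r s == 1%:M].
have ker_group : group_set ker.
  apply/group_setP; split; first by rewrite inE odd_perm1 r1 eqxx.
  move=> x y; rewrite !inE => /andP[/negbTE ex /eqP rx] /andP[/negbTE ey /eqP ry].
  by rewrite odd_permM ex ey rM // rx ry mulmx1 eqxx.
pose K := Group ker_group.
have KN : (K <| 'Alt_T)%g.
  apply/andP; split.
    by apply/subsetP => x; rewrite inE Alt_even => /andP[].
  apply/subsetP => x; rewrite Alt_even inE => /negbTE ex.
  apply/subsetP => y /imsetP[z]; rewrite inE => /andP[/negbTE ez /eqP rz] ->.
  have exV : x^-1%g = false :> bool by rewrite odd_permV.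
  rewrite inE conjgE !odd_permM exV ez ex /= rM ?odd_permM ?ez // rM // rz mul1mx -rM // mulVg r1.
  exact: eqxx.
have [_ /(_ K KN)[K1|KA]] := simpleP _ (simple_Alt5 T5).
  have [z z1 [ez rz]] := small_repr_trivial_on_some.
  have : z \in K by rewrite inE ez rz eqxx.
  by rewrite K1 inE (negPf z1).
have : (s \in 'Alt_T)%g by rewrite Alt_even es.
by rewrite -KA inE => /andP[_ /eqP].
Qed.

End SmallRepresentations.

Local Close Scope ring_scope.

(** * A branch group *)

From mathcomp Require Import finmap all_classical all_reals all_analysis complex.
From Stdlib Require Eqdep_dec PeanoNat.

Local Open Scope group_scope.

Section SubgroupLemmas.
Variables (G : groupType).
Implicit Types (S N : set G).

Lemma smallest_subgroup S : is_subgroup (smallest (@is_subgroup G) S).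
Proof.
split=> [A [[A1 _ _] _] //|x y hx hy A hA|x hx A hA].
  by have [_ AM _] := hA.1; apply: AM; [apply: hx | apply: hy].
by have [_ _ AV] := hA.1; apply: AV; apply: hx.
Qed.

Lemma subgroupJ N x y : is_subgroup N -> N x -> N y -> N (x ^ y).
Proof. by move=> [_ NM NV] Nx Ny; rewrite conjgE; apply: (NM); [exact: NV | exact: NM]. Qed.

Lemma subgroupR N x y : is_subgroup N -> N x -> N y -> N [~ x, y].
Proof.
by move=> sN Nx Ny; rewrite commgEl; have [_ NM NV] := sN; apply: NM; [exact: NV | exact: subgroupJ].
Qed.

End SubgroupLemmas.

(* [words k J] is the k-th level of the rooted tree whose vertices of depth i have
   the alphabet of [J i] as children. *)
Definition stail (J : nat -> nat) i := J i.+1.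

Fixpoint stailn k (J : nat -> nat) : nat -> nat :=
  if k is k'.+1 then stailn k' (stail J) else J.

Lemma stailn0 k J : stailn k J 0 = J k.
Proof. by elim: k J => //= k IH J; rewrite IH. Qed.

Fixpoint words k (J : nat -> nat) : finType :=
  if k is k'.+1 then (alphabet (J 0%N) * words k' (stail J))%type : finType else unit.

(** No compatibility between levels is imposed, so the group structure is levelwise; the generators
    below respect the tree by construction. *)
Definition tree_aut J := forall k, {perm words k J}.
HB.instance Definition _ J := gen_eqMixin (tree_aut J).
HB.instance Definition _ J := gen_choiceMixin (tree_aut J).

Lemma perm_unit_eq (s t : {perm unit}) : s = t.
Proof. by apply/permP => x; case: (s x); case: (t x). Qed.

Section AutGroup.
Variable J : nat -> nat.
Definition aut_mul (f g : tree_aut J) : tree_aut J := fun k => f k * g k.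
Definition aut_one : tree_aut J := fun k => 1.
Definition aut_inv (f : tree_aut J) : tree_aut J := fun k => (f k)^-1.

Lemma aut_mulA : associative aut_mul.
Proof. by move=> f g h; apply: functional_extensionality_dep => k; apply: mulgA. Qed.
Lemma aut_mul1 : left_id aut_one aut_mul.
Proof. by move=> f; apply: functional_extensionality_dep => k; apply: mul1g. Qed.
Lemma aut_1mul : right_id aut_one aut_mul.
Proof. by move=> f; apply: functional_extensionality_dep => k; apply: mulg1. Qed.
Lemma aut_mulV : left_inverse aut_one aut_inv aut_mul.
Proof. by move=> f; apply: functional_extensionality_dep => k; apply: mulVg. Qed.
Lemma aut_Vmul : right_inverse aut_one aut_inv aut_mul.
Proof. by move=> f; apply: functional_extensionality_dep => k; apply: mulgV. Qed.

HB.instance Definition _ := isGroup.Build (tree_aut J) aut_mulA aut_mul1 aut_1mul aut_mulV aut_Vmul.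

End AutGroup.

(** * Wreath recursion: rooted elements and sections *)

Section Wreath.
Variable J : nat -> nat.
Local Notation X := (alphabet (J 0%N)).

Section WreathLevel.
Variables (k : nat) (F : X -> {perm words k (stail J)}) (p : {perm X}).

Definition wreath_fun (u : words k.+1 J) : words k.+1 J := (p u.1, F u.1 u.2).

Lemma wreath_fun_inj : injective wreath_fun.
Proof.
move=> [x w] [y w'] [e1 e2]; move: e1 e2 => /perm_inj -> /perm_inj ->.
by [].
Qed.

Definition wreath_level : {perm words k.+1 J} := perm wreath_fun_inj.

Lemma wreath_levelE x w : wreath_level (x, w) = (p x, F x w).
Proof. by rewrite permE. Qed.
End WreathLevel.

Definition wr (F : X -> tree_aut (stail J)) (p : {perm X}) : tree_aut J :=
  fun k => if k is k'.+1 then wreath_level (fun x => F x k') p else 1.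

Lemma wrE F p k x w : wr F p k.+1 (x, w) = (p x, F x k w).
Proof. by rewrite /= permE. Qed.

Lemma wrM F p G q : wr F p * wr G q = wr (fun x => F x * G (p x)) (p * q).
Proof.
apply: functional_extensionality_dep => -[|k]; first exact: perm_unit_eq.
by apply/permP => -[x w]; rewrite wrE [LHS]permM !wrE !permM.
Qed.

Lemma wr1 : wr (fun _ => 1) 1 = 1.
Proof.
apply: functional_extensionality_dep => -[|k]; first exact: perm_unit_eq.
by apply/permP => -[x w]; rewrite wrE !perm1.
Qed.

Lemma eq_wr F G p : (forall x, F x = G x) -> wr F p = wr G p.
Proof. by move=> h; congr wr; apply/funext. Qed.

Lemma wrV F p : (wr F p)^-1 = wr (fun x => (F (p^-1 x))^-1) p^-1.
Proof.
apply: (mulgI (wr F p)); rewrite mulgV wrM mulgV -wr1.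
by apply: eq_wr => x; rewrite permK mulgV.
Qed.

Definition rooted p := wr (fun _ => 1) p.
Definition base F := wr F 1.
Definition at_child (x : X) (f : tree_aut (stail J)) := base (fun y => if y == x then f else 1).

Lemma rootedM p q : rooted (p * q) = rooted p * rooted q.
Proof. by rewrite /rooted wrM; apply: eq_wr => x; rewrite mulg1. Qed.

Lemma rooted1 : rooted 1 = 1. Proof. exact: wr1. Qed.

Lemma rootedV p : rooted p^-1 = (rooted p)^-1.
Proof. by rewrite /rooted wrV; apply: eq_wr => x; rewrite invg1. Qed.

Lemma base_rooted F p : wr F p = base F * rooted p.
Proof. by rewrite /base /rooted wrM mul1g; apply: eq_wr => x; rewrite mulg1. Qed.

Lemma baseM F G : base F * base G = base (fun x => F x * G x).
Proof. by rewrite /base wrM mul1g; apply: eq_wr => x; rewrite perm1. Qed.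

Lemma baseV F : (base F)^-1 = base (fun x => (F x)^-1).
Proof. by rewrite /base wrV invg1; apply: eq_wr => x; rewrite perm1. Qed.

Lemma baseJ F p : base F ^ rooted p = base (fun x => F (p^-1 x)).
Proof.
rewrite conjgE -rootedV /rooted /base !wrM mul1g mulVg.
by apply: eq_wr => x; rewrite mul1g mulg1.
Qed.

Lemma baseR F G : [~ base F, base G] = base (fun x => [~ F x, G x]).
Proof. by rewrite commgEl conjgE !baseV !baseM; apply: eq_wr => x; rewrite commgEl conjgE. Qed.

Lemma base1 : base (fun _ => 1) = 1. Proof. exact: wr1. Qed.

Lemma at_childM x f g : at_child x (f * g) = at_child x f * at_child x g.
Proof. by rewrite /at_child baseM; apply: eq_wr => y; case: eqP; rewrite ?mulg1. Qed.

Lemma at_child1 x : at_child x 1 = 1.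
Proof. by rewrite -base1; apply: eq_wr => y; case: eqP. Qed.

Lemma at_childV x f : at_child x f^-1 = (at_child x f)^-1.
Proof. by rewrite /at_child baseV; apply: eq_wr => y; case: eqP; rewrite ?invg1. Qed.

Lemma at_childJ x f p : at_child x f ^ rooted p = at_child (p x) f.
Proof.
by rewrite /at_child baseJ; apply: eq_wr => y; rewrite -(inj_eq (@perm_inj _ p)) permKV.
Qed.

Lemma base_ind (N : set (tree_aut J)) F : is_subgroup N ->
  (forall x, N (at_child x (F x))) -> N (base F).
Proof.
move=> [N1 NM NV] NF.
pose f (S : seq X) := base (fun x => if x \in S then F x else 1).
have Nf S : uniq S -> N (f S).
  elim: S => [_|x S IH /= /andP[xS uS]]; first by rewrite /f base1.
  rewrite (_ : f _ = at_child x (F x) * f S); first by apply: (NM) => //; apply: IH.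
  rewrite /f /at_child baseM; apply: eq_wr => y; rewrite inE.
  by have [->|_] := eqVneq y x; rewrite /= ?(negPf xS) ?mulg1 ?mul1g.
have -> : base F = f (enum X) by apply: eq_wr => x; rewrite mem_enum.
exact/Nf/enum_uniq.
Qed.

End Wreath.

(** The directed automorphism along the ray through [pt0]: at each step the neighbour [pt1] receives
    the rooted action of [p]. It is built level by level because its section at [pt0] is the same
    kind of element again. *)
Fixpoint dir_level (l : 'I_3) (p : {perm 'I_5}) k J : {perm words k J} :=
  if k is k'.+1 then
    wreath_level (fun x : alphabet (J 0%N) =>
      if x == pt0 _ then dir_level l p k' (stail J)
      else if x == pt1 _ then rooted (blk (J 1%N) l p) k' else 1) 1
  else 1.

Definition dir l p J : tree_aut J := fun k => dir_level l p k J.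

Definition dir_sections l p J (x : alphabet (J 0%N)) : tree_aut (stail J) :=
  if x == pt0 _ then dir l p (stail J)
  else if x == pt1 _ then @rooted (stail J) (blk (stail J 0) l p) else 1.

Lemma dirE l p J : dir l p J = base (@dir_sections l p J).
Proof.
apply: functional_extensionality_dep => -[|k] //=; rewrite /base /wr.
congr wreath_level; apply/funext => x; rewrite /dir_sections; by do 2?case: eqP.
Qed.

Lemma dirM l p q J : dir l (p * q) J = dir l p J * dir l q J.
Proof.
apply: functional_extensionality_dep => k; rewrite /dir.
elim: k J => [|k IH] J; first by apply: esym; apply: mulg1.
apply/permP => -[x w]; rewrite [RHS]permM /= !wreath_levelE !perm1.
congr (_, _); have [x0|x0] := eqVneq x (pt0 _); first by rewrite IH permM.
by case: eqP => _; rewrite ?perm1 // blkM rootedM [LHS]permM.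
Qed.

Lemma dir1 l J : dir l 1 J = 1.
Proof. by apply: (mulgI (dir l 1 J)); rewrite -dirM !mulg1. Qed.

Lemma dirV l p J : dir l p^-1 J = (dir l p J)^-1.
Proof. by apply: (mulgI (dir l p J)); rewrite -dirM !mulgV dir1. Qed.

Definition gens J : set (tree_aut J) := fun f =>
  (exists2 p : {perm alphabet (J 0%N)}, p = false :> bool & f = rooted p) \/
  (exists (l : 'I_3) (p : {perm 'I_5}), p = false :> bool /\ f = dir l p J).

Definition branch J : set (tree_aut J) := smallest (@is_subgroup (tree_aut J)) (@gens J).

Lemma branch_subgroup J : is_subgroup (@branch J).
Proof. exact: smallest_subgroup. Qed.

Lemma branch_ind J (N : set (tree_aut J)) : is_subgroup N ->
    (forall p : {perm alphabet (J 0%N)}, p = false :> bool -> N (rooted p)) ->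
    (forall l (p : {perm 'I_5}), p = false :> bool -> N (dir l p J)) ->
  forall f, branch f -> N f.
Proof.
move=> sN Nroot Ndir f; apply; split=> // g [[p ep ->]|[l [p [ep ->]]]].
  exact: Nroot.
exact: Ndir.
Qed.

Lemma branch_rooted J (p : {perm alphabet (J 0%N)}) : p = false :> bool -> branch (rooted p).
Proof. by move=> ep A hA; apply: hA.2; left; exists p. Qed.

Lemma branch_dir J l (p : {perm 'I_5}) : p = false :> bool -> branch (dir l p J).
Proof. by move=> ep A hA; apply: hA.2; right; exists l, p. Qed.

Lemma alphabet_gt2 j : (2 < #|alphabet j|)%N.
Proof. by rewrite card_alphabet mulnS. Qed.

Section Separation.
Variable j : nat.
Local Notation X := (alphabet j).
Let c : X := cell j 0 0.
Let c' : X := cell j 0 1.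

Lemma cells_neq : c != c'.
Proof. by apply/eqP => /cell_inj[]. Qed.

Lemma separate0 : exists a : {perm X},
  [/\ a = false :> bool, a (pt1 j) = pt1 j & a (pt0 j) != pt0 j].
Proof.
exists (tri (pt0 j) c c').
have u : uniq [:: pt0 j; c; c'] by rewrite cons_uniq inE negb_or /= inE cells_neq.
split; first exact: tri_even; first by rewrite tri_out.
by have [-> _ _] := triE u.
Qed.

Lemma separate1 : exists a : {perm X},
  [/\ a = false :> bool, a (pt0 j) = pt0 j & a (pt1 j) != pt1 j].
Proof.
exists (tri (pt1 j) c c').
have u : uniq [:: pt1 j; c; c'] by rewrite cons_uniq inE negb_or /= inE cells_neq.
split; first exact: tri_even; first by rewrite tri_out.
by have [-> _ _] := triE u.
Qed.

(** Conjugation by such a rooted element moves the nontrivial sections of a directed element off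
    both special points, so the result commutes with every unconjugated one. *)
Lemma separate01 : exists a : {perm X}, [/\ a = false :> bool,
  a^-1 (pt0 j) \notin [:: pt0 j; pt1 j] & a^-1 (pt1 j) \notin [:: pt0 j; pt1 j]].
Proof.
have cc := cells_neq.
exists (tperm (pt0 j) c * tperm (pt1 j) c'); split.
- by rewrite odd_permM !odd_tperm.
- have e : tperm (pt1 j) c' (pt0 j) = pt0 j by rewrite tpermD.
  by rewrite invMg !tpermV permM e tpermL.
- have e : tperm (pt0 j) c c' = c' by rewrite tpermD // eq_sym.
  by rewrite invMg !tpermV permM tpermL e.
Qed.

End Separation.

(** * The branching property *)

Section Branching.
Variable J : nat -> nat.
Local Notation J' := (stail J).
Local Notation x0 := (pt0 (J 0%N)).
Local Notation x1 := (pt1 (J 0%N)).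

Lemma dir_sections0 l p : @dir_sections l p J x0 = dir l p J'.
Proof. by rewrite /dir_sections eqxx. Qed.

Lemma dir_sections1 l p : @dir_sections l p J x1 = rooted (blk (J' 0%N) l p).
Proof. by rewrite /dir_sections eqxx. Qed.

Lemma dir_sections_out l p x : x != x0 -> x != x1 -> @dir_sections l p J x = 1.
Proof. by rewrite /dir_sections => /negPf -> /negPf ->. Qed.

Lemma at_child_trans x y f : branch (@at_child J x f) -> branch (@at_child J y f).
Proof.
move=> h; have [p ep <-] := even_trans x y (alphabet_gt2 _).
by rewrite -at_childJ; apply: (subgroupJ (branch_subgroup J)) h _; apply: branch_rooted.
Qed.

(* If [a] fixes one of the two special points and moves the other,
   [dir p] and the conjugate of [dir q] by [rooted a] meet in a single child. *)
Lemma at_x1_commutator l (p q : {perm 'I_5}) : p = false :> bool -> q = false :> bool ->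
  branch (@at_child J x1 (rooted (blk (J' 0%N) l [~ p, q]))).
Proof.
move=> ep eqq; have [a [ea a1 a0]] := separate0 (J 0%N).
have : branch [~ dir l p J, dir l q J ^ rooted a].
  apply: (subgroupR (branch_subgroup J)); first exact: branch_dir.
  by apply: (subgroupJ (branch_subgroup J)); [exact: branch_dir | exact: branch_rooted].
rewrite !dirE baseJ baseR; congr branch; apply: eq_wr => x.
have a1' : a^-1 x1 = x1 by rewrite -{1}a1 permK.
have [->|nx1] := eqVneq x x1.
  by rewrite a1' !dir_sections1 !commgEl !conjgE !blkM !blkV !rootedM !rootedV.
have [->|nx0] := eqVneq x x0; last by rewrite dir_sections_out // comm1g.
rewrite [X in [~ _, X]]dir_sections_out ?commg1 //.
  by apply: contraNneq a0 => e; rewrite -{1}e permKV.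
by rewrite -a1' (inj_eq (@perm_inj _ _)).
Qed.

Lemma at_x0_commutator l (p q : {perm 'I_5}) : p = false :> bool -> q = false :> bool ->
  branch (@at_child J x0 (dir l [~ p, q] J')).
Proof.
move=> ep eqq; have [a [ea a0 a1]] := separate1 (J 0%N).
have : branch [~ dir l p J, dir l q J ^ rooted a].
  apply: (subgroupR (branch_subgroup J)); first exact: branch_dir.
  by apply: (subgroupJ (branch_subgroup J)); [exact: branch_dir | exact: branch_rooted].
rewrite !(dirE l _ J) baseJ baseR; congr branch; apply: eq_wr => x.
have a0' : a^-1 x0 = x0 by rewrite -{1}a0 permK.
have [->|nx0] := eqVneq x x0.
  by rewrite a0' !dir_sections0 !commgEl !conjgE !dirM !dirV.
have [->|nx1] := eqVneq x x1; last by rewrite dir_sections_out // comm1g.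
rewrite [X in [~ _, X]]dir_sections_out ?commg1 //.
  by rewrite -a0' (inj_eq (@perm_inj _ _)).
by apply: contraNneq a1 => e; rewrite -{1}e permKV.
Qed.

Lemma pullback_subgroup (N : set (tree_aut J)) (G : groupType) (f : G -> tree_aut J) :
  f 1 = 1 -> {morph f : x y / x * y} -> is_subgroup N -> is_subgroup (fun x => N (f x)).
Proof.
move=> f1 fM [N1 NM NV]; split; first by rewrite f1.
  by move=> x y hx hy; rewrite fM; apply: NM.
move=> x hx; suff -> : f x^-1 = (f x)^-1 by apply: NV.
by apply: (mulgI (f x)); rewrite -fM !mulgV.
Qed.

(** Commutators place [blk] elements at [pt1] and directed elements at [pt0]. Perfection of [A_5]
    removes the commutators, [blk_gen] yields the whole rooted group of the subtree, and
    transitivity of the rooted elements reaches every child. *)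
Lemma branch_at_child x f : branch f -> branch (@at_child J x f).
Proof.
move: f; apply: branch_ind.
- apply: pullback_subgroup (branch_subgroup J); first exact: at_child1.
  exact: at_childM.
- move=> p ep; apply: (@at_child_trans x1).
  have [h1 hM hV] := branch_subgroup J.
  move: p ep; apply: (@blk_gen (J' 0%N) (fun p => branch (@at_child J x1 (rooted p)))).
  + by rewrite rooted1 at_child1.
  + by move=> s t hs ht; rewrite rootedM at_childM; apply: hM.
  + by move=> s hs; rewrite rootedV at_childV; apply: hV.
  move=> l; apply: alt_perfect => //; first by rewrite card_ord.
  + by rewrite blk1 rooted1 at_child1.
  + by move=> s t hs ht; rewrite blkM rootedM at_childM; apply: hM.
  + by move=> s hs; rewrite blkV rootedV at_childV; apply: hV.
  exact: at_x1_commutator.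
- move=> l p ep; apply: (@at_child_trans x0).
  have [h1 hM hV] := branch_subgroup J.
  move: p ep; apply: alt_perfect => //; first by rewrite card_ord.
  + by rewrite dir1 at_child1.
  + by move=> s t hs ht; rewrite dirM at_childM; apply: hM.
  + by move=> s hs; rewrite dirV at_childV; apply: hV.
  exact: at_x0_commutator.
Qed.

Lemma branch_base F : (forall x, branch (F x)) -> branch (@base J F).
Proof. by move=> hF; apply: base_ind => [|x]; [exact: branch_subgroup | exact: branch_at_child]. Qed.

(** Converse to [branch_base] and [branch_rooted]: the group is the full wreath product of its
    next-level analogue by the alternating group of the root. *)
Lemma branch_wr f : branch f -> exists (p : {perm alphabet (J 0%N)}) F,
  [/\ p = false :> bool, forall x, branch (F x) & f = @wr J F p].
Proof.
move: f; apply: branch_ind.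
- have hs := branch_subgroup J'; have [h1 hM hV] := hs; split.
  + by exists 1, (fun _ => 1); split; rewrite ?odd_perm1 // wr1.
  + move=> _ _ [p [F [ep hF ->]]] [q [G [eq hG ->]]].
    exists (p * q), (fun x => F x * G (p x)); split; rewrite ?wrM ?odd_permM ?ep ?eq //.
    by move=> x; apply: hM.
  + move=> _ [p [F [ep hF ->]]]; rewrite wrV.
    exists p^-1, (fun x => (F (p^-1 x))^-1); split; rewrite ?odd_permV // => x.
    exact: hV.
- by move=> p ep; exists p, (fun _ => 1); split=> // _; have [] := branch_subgroup J'.
- move=> l p ep; exists 1, (@dir_sections l p J); split; rewrite ?odd_perm1 ?dirE // => x.
  rewrite /dir_sections; case: eqP => _; first exact: branch_dir.
  case: eqP => _; first by apply: branch_rooted; apply: blk_even.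
  by have [] := branch_subgroup J'.
Qed.

End Branching.

Fixpoint at_level k J : (words k J -> tree_aut (stailn k J)) -> tree_aut J :=
  match k with
  | 0 => fun F => F tt
  | k'.+1 => fun F => @base J (fun x => @at_level k' (stail J) (fun w => F (x, w)))
  end.

Lemma at_levelS k J F :
  @at_level k.+1 J F = base (fun x => at_level (fun w => F (x, w))).
Proof. by []. Qed.

Lemma at_levelE k J F i x w :
  @at_level k.+1 J F i.+1 (x, w) = (x, at_level (fun w => F (x, w)) i w).
Proof. by rewrite at_levelS [LHS]wrE perm1. Qed.

Lemma eq_at_level k J F G : (forall w, F w = G w) -> @at_level k J F = @at_level k J G.
Proof. by move=> h; congr at_level; apply/funext. Qed.

Lemma at_levelM k J F G : @at_level k J F * @at_level k J G = @at_level k J (fun w => F w * G w).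
Proof. by elim: k J F G => //= k IH J F G; rewrite baseM; apply: eq_wr => x; apply: IH. Qed.

Lemma at_level1 k J : @at_level k J (fun _ => 1) = 1.
Proof. by elim: k J => //= k IH J; rewrite -[RHS]base1; apply: eq_wr => x; apply: IH. Qed.

Lemma at_levelV k J F : (@at_level k J F)^-1 = @at_level k J (fun w => (F w)^-1).
Proof.
apply: (mulgI (at_level F)); rewrite mulgV at_levelM -(at_level1 k J).
by apply: eq_at_level => w; rewrite mulgV.
Qed.

Lemma branch_at_level k J F : (forall w, branch (F w)) -> branch (@at_level k J F).
Proof.
elim: k J F => [|k IH] J F hF; first exact: hF.
by apply: branch_base => x; apply: IH => w; apply: hF.
Qed.

Lemma at_level_low k J F i : (i <= k)%N -> (0 < k)%N -> @at_level k J F i = 1.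
Proof.
elim: k J F i => [//|k IH] J F [|i] ik _; first exact: perm_unit_eq.
have h x : at_level (fun w => F (x, w)) i = 1.
  case: k IH F ik => [|k] IH F ik; last exact: IH.
  by case: i ik => // _; apply: perm_unit_eq.
by apply/permP => -[x w]; rewrite at_levelE h !perm1.
Qed.

Lemma at_level_next k J F : (forall w, F w 1%N = 1) -> @at_level k J F k.+1 = 1.
Proof.
elim: k J F => [|k IH] J F hF; first exact: hF.
have h x : at_level (fun w => F (x, w)) k.+1 = 1 by apply: IH.
by apply/permP => -[x w]; rewrite at_levelE h !perm1.
Qed.

Lemma at_level_next_inv k J F : @at_level k J F k.+1 = 1 -> forall w, F w 1%N = 1.
Proof.
elim: k J F => [|k IH] J F hF; first by case.
move=> [x w]; apply: (IH _ (fun w => F (x, w))); apply/permP => v.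
have := congr1 (fun s : {perm words k.+2 J} => (s (x, v)).2) hF.
by rewrite at_levelE !perm1.
Qed.

Lemma pt_words k J : exists w : words k J, True.
Proof. by elim: k J => [|k IH] J; [exists tt | have [w _] := IH (stail J); exists (pt0 _, w)]. Qed.

(** With [branch_at_level], the stabilizer of level [k] is exactly a direct product of the groups of
    the subtrees. *)
Lemma branch_stabilizer k J f : branch f -> f k = 1 ->
  exists2 F, (forall w, branch (F w)) & f = @at_level k J F.
Proof.
elim: k J f => [|k IH] J f bf fk; first by exists (fun _ => f).
have [p [F [ep bF ef]]] := branch_wr bf; subst f.
have p1 : p = 1.
  apply/permP => x; have [w _] := pt_words k (stail J).
  by have := congr1 (fun s : {perm words k.+1 J} => (s (x, w)).1) fk; rewrite /= wrE !perm1.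
have Fk x : F x k = 1.
  apply/permP => w.
  by have := congr1 (fun s : {perm words k.+1 J} => (s (x, w)).2) fk; rewrite /= wrE !perm1.
have ex x : exists G, (forall w, branch (G w)) /\ F x = @at_level k (stail J) G.
  by have [G ? ?] := IH _ _ (bF x) (Fk x); exists G.
have [G GP] := choice ex.
exists (fun w => G w.1 w.2); first by move=> [x w]; have [h _] := GP x; apply: h.
by rewrite p1; apply: eq_wr => x; have [_ ->] := GP x.
Qed.

Definition at_word k J (w : words k J) f := @at_level k J (fun w' => if w' == w then f else 1).

Lemma at_wordM k J w f g : @at_word k J w (f * g) = at_word w f * at_word w g.
Proof. by rewrite /at_word at_levelM; apply: eq_at_level => v; case: eqP; rewrite ?mulg1. Qed.

Lemma at_word1 k J w : @at_word k J w 1 = 1.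
Proof. by rewrite -(at_level1 k J); apply: eq_at_level => v; case: eqP. Qed.

Lemma at_wordV k J w f : @at_word k J w f^-1 = (at_word w f)^-1.
Proof. by rewrite /at_word at_levelV; apply: eq_at_level => v; case: eqP; rewrite ?invg1. Qed.

Lemma at_level_ind k J (N : set (tree_aut J)) F : is_subgroup N ->
  (forall w, N (@at_word k J w (F w))) -> N (@at_level k J F).
Proof.
move=> [N1 NM NV] NF.
pose f (S : seq (words k J)) := at_level (fun w => if w \in S then F w else 1).
have Nf S : uniq S -> N (f S).
  elim: S => [_|x S IH /= /andP[xS uS]]; first by rewrite /f at_level1.
  rewrite (_ : f _ = at_word x (F x) * f S); first by apply: (NM) => //; apply: IH.
  rewrite /f /at_word at_levelM; apply: eq_at_level => y; rewrite inE.
  by have [->|_] := eqVneq y x; rewrite /= ?(negPf xS) ?mulg1 ?mul1g.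
have -> : at_level F = f (enum (words k J)) by apply: eq_at_level => w; rewrite mem_enum.
exact/Nf/enum_uniq.
Qed.

(* Modulo [N], [dir q] equals its conjugate by a rooted element, and a suitable
   such conjugate commutes with [dir p]. *)
Lemma normal_closure_rooted k J (N : set (tree_aut J)) :
    is_subgroup N -> (forall f g, N f -> branch g -> N (f ^ g)) ->
    (forall w (p : {perm alphabet (stailn k J 0%N)}), p = false :> bool ->
       N (@at_word k J w (rooted p))) ->
  forall F, (forall w, branch (F w)) -> N (@at_level k J F).
Proof.
move=> sN NJ Nroot F bF; apply: at_level_ind => // w.
have [N1 NM NV] := sN.
move: (F w) (bF w); apply: branch_ind.
- apply: pullback_subgroup sN; first exact: at_word1.
  exact: at_wordM.
- exact: Nroot.
move=> l; apply: alt_perfect; first by rewrite card_ord.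
- by rewrite dir1 at_word1.
- by move=> s t hs ht; rewrite dirM at_wordM; apply: NM.
- by move=> s hs; rewrite dirV at_wordV; apply: NV.
move=> p q ep eqq; have [a [ea a0 a1]] := separate01 (stailn k J 0%N).
set D := at_word w (dir l p _); set E := at_word w (dir l q _); set R := at_word w (rooted a).
have bD (s : {perm 'I_5}) : s = false :> bool -> branch (at_word w (dir l s (stailn k J))).
  move=> es; apply: branch_at_level => v; case: eqP => _; first exact: branch_dir.
  by have [] := branch_subgroup (stailn k J).
rewrite (_ : at_word w _ = [~ D, E]); last first.
  by rewrite !commgEl !conjgE !dirM !dirV !at_wordM !at_wordV.
have DER : [~ D, E ^ R] = 1.
  transitivity (at_word w [~ dir l p _, dir l q _ ^ rooted a]).
    by rewrite !commgEl !conjgE; do !rewrite ?at_wordM ?at_wordV.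
  rewrite -[RHS](at_word1 w); congr at_word; rewrite !dirE baseJ baseR -[RHS]base1.
  apply: eq_wr => x.
  have [->|nx0] := eqVneq x (pt0 _).
    rewrite [X in [~ _, X]]dir_sections_out ?commg1 //;
    by move: a0; rewrite !inE negb_or => /andP[].
  have [->|nx1] := eqVneq x (pt1 _); last by rewrite dir_sections_out ?comm1g.
  rewrite [X in [~ _, X]]dir_sections_out ?commg1 //;
  by move: a1; rewrite !inE negb_or => /andP[].
(* As [R] lies in the normal subgroup [N], this says that [E] and [E ^ R] agree modulo [N]. *)
have NER : N [~ E, R].
  rewrite commgEr; apply: NM; last exact: Nroot.
  by apply: NJ; [apply: NV; exact: Nroot | exact: bD].
have cDER : D ^ (E ^ R) = D by move: DER; rewrite commgEl => /(canRL (mulKg _)); rewrite mulg1 invgK.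
(* Since [E ^ R = E * [~ E, R]] centralizes [D], conjugating [D] by [E] amounts to conjugating it by
   the inverse of [[~ E, R]]. *)
have -> : [~ D, E] = ([~ E, R] ^ D) * [~ E, R]^-1.
  have cDE : D ^ E = D ^ [~ E, R]^-1 by rewrite -{2}cDER -conjgM commgEl invMg invgK mulKVg.
  by rewrite commgEl cDE !conjgE invgK !mulgA.
apply: NM; last exact: NV.
by apply: NJ => //; apply: bD.
Qed.

Definition branch_group J := {f : tree_aut J | `[< branch f >]}.
HB.instance Definition _ J := Choice.on (branch_group J).

Section BranchGroup.
Variable J : nat -> nat.
Local Notation G := (branch_group J).
Implicit Types f g : G.

Lemma branch_groupP f : branch (val f).
Proof. exact/asboolP/(valP f). Qed.

Definition to_branch (f : tree_aut J) (bf : branch f) : G := exist _ f (introT (asboolP _) bf).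

Let sub := branch_subgroup J.
Definition branch_one : G := let: And3 h _ _ := sub in to_branch h.
Definition branch_mul f g : G :=
  let: And3 _ h _ := sub in to_branch (h _ _ (branch_groupP f) (branch_groupP g)).
Definition branch_inv f : G := let: And3 _ _ h := sub in to_branch (h _ (branch_groupP f)).

Lemma val_branch_one : val branch_one = 1.
Proof. by rewrite /branch_one; case: sub. Qed.
Lemma val_branch_mul f g : val (branch_mul f g) = val f * val g.
Proof. by rewrite /branch_mul; case: sub. Qed.
Lemma val_branch_inv f : val (branch_inv f) = (val f)^-1.
Proof. by rewrite /branch_inv; case: sub. Qed.

Lemma branch_mulA : associative branch_mul.
Proof. by move=> f g h; apply: val_inj; rewrite !val_branch_mul mulgA. Qed.
Lemma branch_mul1 : left_id branch_one branch_mul.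
Proof. by move=> f; apply: val_inj; rewrite val_branch_mul val_branch_one mul1g. Qed.
Lemma branch_1mul : right_id branch_one branch_mul.
Proof. by move=> f; apply: val_inj; rewrite val_branch_mul val_branch_one mulg1. Qed.
Lemma branch_mulV : left_inverse branch_one branch_inv branch_mul.
Proof.
by move=> f; apply: val_inj; rewrite val_branch_mul val_branch_one val_branch_inv mulVg.
Qed.
Lemma branch_Vmul : right_inverse branch_one branch_inv branch_mul.
Proof.
by move=> f; apply: val_inj; rewrite val_branch_mul val_branch_one val_branch_inv mulgV.
Qed.

End BranchGroup.

HB.instance Definition _ J := isGroup.Build (branch_group J)
  (@branch_mulA J) (@branch_mul1 J) (@branch_1mul J) (@branch_mulV J) (@branch_Vmul J).

(** * Finite generation, residual finiteness, infinitude, and the coset decomposition *)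

Section Properties.
Variable J : nat -> nat.
Local Notation G := (branch_group J).

Lemma val_branch1 : val (1 : G) = 1. Proof. exact: val_branch_one. Qed.
Lemma val_branchM (f g : G) : val (f * g) = val f * val g. Proof. exact: val_branch_mul. Qed.
Lemma val_branchV (f : G) : val f^-1 = (val f)^-1. Proof. exact: val_branch_inv. Qed.

Lemma branch_finitely_generated : finitely_generated G.
Proof.
pose S : set G := [set f : G | gens (val f)]%classic.
exists S; split.
  have fin : finite_set ((fun p => @rooted J p) @` setT `|` (fun lp => dir lp.1 lp.2 J) @` setT)%classic.
    by rewrite finite_setU; split; apply: finite_image; apply: finite_finset.
  apply: (@sub_finite_set _ _ (val @^-1` ((fun p => @rooted J p) @` setT `|` (fun lp => dir lp.1 lp.2 J) @` setT)%classic)).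
    move=> f [[p _ e]|[l [p [_ e]]]]; [left; exists p => // | right; exists (l, p) => //].
  by apply: finite_preimage => // f g _ _; apply: val_inj.
apply/seteqP; split=> // f _.
have [S1 SM SV] := smallest_subgroup S.
pose N : set (tree_aut J) := fun g => exists2 h : G, val h = g & smallest (@is_subgroup G) S h.
suff [h /val_inj <- //] : N (val f).
have Ngens g : gens g -> N g.
  move=> hg; have bg : branch g by move=> A [_ hA]; apply: hA.
  by exists (to_branch bg) => // A [_ hA]; apply: hA; exact: hg.
apply: (branch_ind (N := N)) (branch_groupP f).
- split; first by exists 1 => //; exact: val_branch1.
    by move=> _ _ [x <- Nx] [y <- Ny]; exists (x * y); [rewrite val_branchM | apply: SM].
  by move=> _ [x <- Nx]; exists x^-1; [rewrite val_branchV | apply: SV].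
- by move=> p ep; apply: Ngens; left; exists p.
- by move=> l p ep; apply: Ngens; right; exists l, p.
Qed.

Lemma branch_residually_finite : residually_finite G.
Proof.
move=> f f1.
have [k fk] : exists k, val f k <> 1.
  apply: contrapT => no; apply: f1; apply: val_inj; rewrite val_branch1.
  apply: functional_extensionality_dep => k; apply: contrapT => h; apply: no.
  by exists k.
pose pr (g : G) : {perm words k J} := val g k.
have prM : {morph pr : x y / x * y} by move=> x y; rewrite /pr val_branchM.
pose h : {multiplicative G -> {perm words k J}} := HB.pack pr (isMultiplicative.Build _ _ pr prM).
by exists {perm words k J}, h.
Qed.

Lemma iota_branch k (a : alt_power (words k J) (alphabet (stailn k J 0))) :
  branch (@at_level k J (fun w => rooted (val (a w)))).
Proof. by apply: branch_at_level => w; apply: branch_rooted; apply: alt_typeP. Qed.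

Definition level_alt_iota k a : G := to_branch (@iota_branch k a).

Lemma val_iota k a : val (@level_alt_iota k a) = @at_level k J (fun w => rooted (val (a w))).
Proof. by []. Qed.

Lemma iota1 k : @level_alt_iota k 1 = 1.
Proof.
apply: val_inj; rewrite val_iota val_branch1 -(at_level1 k J); apply: eq_at_level => w.
by rewrite oneg_ffun rooted1.
Qed.

Lemma iotaM k : {morph @level_alt_iota k : x y / x * y}.
Proof.
move=> x y; apply: val_inj; rewrite val_branchM !val_iota at_levelM.
by apply: eq_at_level => w; rewrite mulg_ffun val_altM rootedM.
Qed.

(** The witness of level [k] acts trivially up to level [k] and nontrivially on the next. Indices
    start at 1 because [at_level_low] needs a positive level. *)
Lemma branch_infinite : infinite_set [set: G]%classic.
Proof.
pose a k : alt_power (words k J) (alphabet (stailn k J 0)) :=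
  [ffun _ => to_alt (tri (pt0 _) (pt1 _) (cell _ 0 0))].
have ntriv k : val (level_alt_iota (a k)) k.+1 != 1.
  apply/eqP; rewrite val_iota => /at_level_next_inv h.
  have [w _] := pt_words k J.
  have u : uniq [:: pt0 (stailn k J 0); pt1 _; cell _ 0 0] by [].
  have := congr1 (fun s : {perm words 1 (stailn k J)} => (s (pt0 _, tt)).1) (h w).
  by rewrite /rooted wrE /= ffunE to_altK ?tri_even // perm1; have [-> _ _] := triE u.
have inj : injective (fun k => level_alt_iota (a k.+1)).
  have lt_neq k k' : (k < k')%N -> level_alt_iota (a k.+1) <> level_alt_iota (a k'.+1).
    move=> kk' e; have := ntriv k.+1; rewrite e val_iota at_level_low ?eqxx //.
  move=> k k' e; have [/lt_neq|/lt_neq|//] := ltngtP k k'; first by [].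
  by move=> h; case: h.
move=> fin; apply: infinite_nat.
have -> : [set: nat]%classic = ((fun k => level_alt_iota (a k.+1)) @^-1` setT)%classic by rewrite preimage_setT.
by apply: finite_preimage => // x y _ _; apply: inj.
Qed.

(** Divided by the representative with the same action on level [k], [g] becomes a product of
    sections. Their rooted parts form an element of the power of the alternating group; the rest
    fixes level [k.+1] and lies in [N] by [normal_closure_rooted]. *)
Lemma branch_cover k : exists t : {perm words k J} -> G,
  forall N : set G, is_subgroup N -> (forall f g, N f -> N (f ^ g)) ->
    (forall a, N (@level_alt_iota k.+1 a)) ->
  forall g, exists j a n, N n /\ g = n * @level_alt_iota k a * t j.
Proof.
have ex (j : {perm words k J}) : exists g : G, (exists g' : G, val g' k = j) -> val g k = j.
  by have [[g gj]|no] := pselect (exists g' : G, val g' k = j); [exists g | exists 1].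
have [t tP] := choice ex.
exists t => N sN NJ Niota g.
pose h := g * (t (val g k))^-1.
have hk : val h k = 1.
  have e : val (t (val g k)) k = val g k by apply: tP; exists g.
  by rewrite val_branchM val_branchV -[LHS]/(val g k * (val (t (val g k)) k)^-1) e mulgV.
have [F bF eF] := branch_stabilizer (branch_groupP h) hk.
have wrF w := branch_wr (bF w).
have [p pP] := choice wrF.
have [E EP] := choice pP.
exists (val g k), [ffun w => to_alt (p w)].
have bn : branch (@at_level k J (fun w => base (E w))).
  by apply: branch_at_level => w; apply: branch_base; have [] := EP w.
exists (to_branch bn); split; last first.
  have -> : to_branch bn * level_alt_iota [ffun w => to_alt (p w)] = h; last by rewrite mulgVK.
  apply: val_inj; rewrite val_branchM val_iota /= at_levelM eF; apply: eq_at_level => w.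
  have [ep _ ->] := EP w; rewrite ffunE to_altK // base_rooted //.
have n1 : @at_level k J (fun w => base (E w)) k.+1 = 1.
  apply: at_level_next => w; apply/permP => -[x []]; rewrite perm1 /base [LHS]wrE perm1.
  by rewrite (perm_unit_eq (E w x 0%N) 1) perm1.
have [F' bF' eF'] := branch_stabilizer bn n1.
pose N' : set (tree_aut J) := fun f => exists2 f' : G, val f' = f & N f'.
have [N1 NM NV] := sN.
have [f' ef' Nf'] : N' (@at_level k.+1 J F').
  apply: normal_closure_rooted bF'.
  - split; first by exists 1 => //; exact: val_branch1.
      by move=> _ _ [x <- Nx] [y <- Ny]; exists (x * y); [rewrite val_branchM | apply: NM].
    by move=> _ [x <- Nx]; exists x^-1; [rewrite val_branchV | apply: NV].
  - move=> _ y [x <- Nx] by_; exists (x ^ to_branch by_); last exact: NJ.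
    by rewrite !conjgE !val_branchM val_branchV.
  - move=> w q eq_; exists (level_alt_iota (at_coord w (to_alt q))); last exact: Niota.
    rewrite val_iota /at_word; apply: eq_at_level => v; rewrite at_coordE.
    by case: eqP => _; rewrite ?to_altK // rooted1.
by have -> : to_branch bn = f' by apply: val_inj; rewrite ef' -eF'.
Qed.

End Properties.

Local Close Scope group_scope.

(** * Counting *)

Local Open Scope ring_scope.

Lemma subset_card_min (T : finType) n : exists Z : {set T},
  (#|Z| <= n)%N /\ ((n <= #|Z|)%N \/ Z = [set: T]%SET).
Proof.
have [nT|nT] := leqP n #|T|; last by exists [set: T]%SET; rewrite cardsT (ltnW nT); split; [|right].
exists [set x in take n (enum T)]; have <- : n = #|[set x in take n (enum T)]|.
  rewrite cardsE (card_uniqP _) ?take_uniq ?enum_uniq // size_take -cardE.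
  by case: ltnP nT => // h1 h2; apply/eqP; rewrite eqn_leq h1 h2.
by split; [|left].
Qed.

Section Kernel.
Variables (F : numClosedFieldType) (G : groupType) (d : nat) (r : G -> 'M[F]_d).
Hypothesis rep : is_repr r.

Lemma repr_mulV g : r g *m r g^-1%g = 1%:M.
Proof. by rewrite -rep.2 mulgV rep.1. Qed.

Lemma repr_kernel_V g : r g = 1%:M -> r g^-1%g = 1%:M.
Proof. by move=> rg; have := repr_mulV g; rewrite rg mul1mx. Qed.

Lemma repr_kernel_J f g : r f = 1%:M -> r (f ^ g)%g = 1%:M.
Proof. by move=> rf; rewrite conjgE !rep.2 rf mul1mx -rep.2 mulVg rep.1. Qed.

End Kernel.

Lemma branch_repr_small (F : numClosedFieldType) J k d (r : branch_group J -> 'M[F]_d) :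
  is_repr r -> (3 * (3 ^ d).+1 <= #|alphabet (J k)|)%N ->
  forall a, r (@level_alt_iota J k a) = 1%:M.
Proof.
move=> rep cT a; have [r1 rM] := rep.
apply: (alt_power_ind (P := fun a => r (level_alt_iota a) = 1%:M)).
- by rewrite iota1.
- by move=> x y hx hy; rewrite iotaM rM hx hy mulmx1.
move=> w; pose q (s : {perm alphabet (stailn k J 0)}) := r (level_alt_iota (at_coord w (to_alt s))).
rewrite -(stailn0 k J) in cT.
have -> : a w = to_alt (val (a w)) by apply: val_inj; rewrite to_altK // alt_typeP.
have q1 : q 1%g = 1%:M.
  rewrite /q (_ : to_alt 1%g = 1%g) ?at_coord1 ?iota1 //; apply: val_inj.
  by rewrite to_altK ?odd_perm1.
rewrite -[LHS]/(q (val (a w))); apply: (small_repr_trivial q1 _ cT); last exact: alt_typeP.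
  by move=> s t es et; rewrite /q to_altM // at_coordM iotaM rM.
by rewrite card_alphabet mulnS.
Qed.

Section Counting.
Variables (F : numClosedFieldType) (J : nat -> nat) (k N s u : nat).
Hypothesis Ns : (N < 2 ^ s.+1)%N.
Hypothesis u_gt0 : (0 < u)%N.
Hypothesis su : (3 * s + 4 <= u * u)%N.
Hypothesis NJ : (3 * (3 ^ N).+1 <= #|alphabet (J k.+1)|)%N.
Variables (I : finType) (d : I -> nat) (r : forall i, branch_group J -> 'M[F]_(d i)).
Hypothesis rep : forall i, is_repr (r i).
Hypothesis irr : forall i, repr_irreducible (r i).
Hypothesis dis : forall i j, i != j -> disjoint_reprs (r i) (r j).
Hypothesis dN : forall i, (d i <= N)%N.

(** All permutations of level [k] serve as coset indices. The resulting factorial is a constant for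
    the level and is absorbed when [N] is large. *)
Theorem branch_irr_count :
  (#|I| <= (#|words k J|)`! * (8 * (u * u).+1 ^ (4 * u)) ^ #|words k J|)%N.
Proof.
have [Z [Zu Zbig]] := subset_card_min (alphabet (stailn k J 0)) (u * u).
have Z1 : (1 < #|Z|)%N.
  case: Zbig => [h|->]; first by apply: leq_trans h; apply: leq_trans su; rewrite addnC.
  by rewrite cardsT card_alphabet.
have ZN : (forall j, (2 ^ j <= N)%N -> (3 * j + 4 <= #|Z|)%N) \/ Z = [set: _]%SET.
  case: Zbig => [h|]; [left=> j jN | by right].
  apply: leq_trans h; apply: leq_trans su; rewrite leq_add2r leq_mul2l /=.
  by rewrite -ltnS -(ltn_exp2l (m := 2)) //; apply: leq_ltn_trans Ns.
have [key keyP] := @alt_power_key (words k J) _ Z u u_gt0 Zu.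
have [t tP] := @branch_cover J k.
have -> : (#|words k J|)`! = #|{: {perm words k J}}| by rewrite -card_Sym cardsT.
rewrite -(@card_alt_power_key (words k J) u).
apply: (@irr_count F (branch_group J) (alt_power (words k J) (alphabet (stailn k J 0)))
  (@level_alt_iota J k) (@iota1 J k) (@iotaM J k) _ t (fix_power_Group _ Z) _ key N keyP _
  I d r rep irr dis dN) => [n q repq nN|g].
  exact: (@alt_power_fixed _ _ Z F N n q repq nN Z1 ZN).
pose ker := [set g | forall i, r i g = 1%:M]%classic : set (branch_group J).
have [|||j [a [n [nK ->]]]] := tP ker _ _ _ g.
- split=> [i|x y hx hy i|x hx i]; first exact: (rep i).1.
    by rewrite (rep i).2 hx hy mulmx1.
  by apply: repr_kernel_V.
- by move=> x y hx i; apply: repr_kernel_J.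
- move=> a i; apply: branch_repr_small => //; apply: leq_trans NJ.
  by rewrite leq_mul2l /= ltnS leq_exp2l.
by exists j, a => i; rewrite !(rep i).2 nK mul1mx.
Qed.

End Counting.

Section SparseSequence.

(** Here [s] plays the part of [log N], and the last inequality says that the count for a level with
    [m] vertices is at most [N ^ (1/k)]. *)
Definition level_bound m k d := forall N : nat, (d < N)%N -> exists s u, [/\ (N < 2 ^ s.+1)%N, (0 < u)%N,
  (3 * s + 4 <= u * u)%N & ((m`! * (8 * (u * u).+1 ^ (4 * u)) ^ m) ^ k <= N)%N].

Lemma level_bound_exists m k : exists d, level_bound m k d.
Proof.
have [s0 hs0] := subexponential k m m`!.
exists (2 ^ s0)%N => N sN; have N0 : (0 < N)%N by apply: leq_ltn_trans sN.
have [h1 h2] := andP (trunc_log_bounds (ltnSn 1) N0).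
have [|u [u0 su hu]] := hs0 (trunc_log 2 N).
  by rewrite -ltnS -(ltn_exp2l (m := 2)) //; apply: leq_ltn_trans h2; apply: ltnW.
by exists (trunc_log 2 N), u; split=> //; apply: leq_trans h1.
Qed.

Lemma card_words k J : #|words k J| = \prod_(i < k) #|alphabet (J i)|.
Proof.
elim: k J => [|k IH] J; first by rewrite big_ord0 card_unit.
by rewrite big_ord_recl /= card_prod IH.
Qed.

(* [J k] is chosen after [J 0, ..., J k.-1], so large that representations of
   degree up to the threshold [d k] of the k-th level are trivial on it. *)
Lemma sparse_sequence : exists (J d : nat -> nat),
  [/\ forall k, (3 * (3 ^ d k).+1 <= #|alphabet (J k)|)%N, forall k, (k <= d k)%N
    & forall k, level_bound #|words k J| k (d k)].
Proof.
have [D DP] := choice (fun mk : nat * nat => level_bound_exists mk.1 mk.2).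
pose d' m k := (D (m, k) + k)%N.
pose j m k := (3 * (3 ^ d' m k).+1)%N.
(* The choice of [J k] needs the number of words of length [k], which depends on the earlier values
   of [J]; [M] computes this number by its own recursion and so breaks the circle. *)
pose M := fix M k := if k is k'.+1 then (M k' * #|alphabet (j (M k') k')|)%N else 1%N.
pose J k := j (M k) k.
have wordsM k : #|words k J| = M k.
  elim: k => [|k IH]; first by rewrite card_unit.
  by rewrite card_words big_ord_recr -card_words IH.
exists J, (fun k => d' (M k) k); split=> k.
- rewrite card_alphabet; apply: leq_trans (leqnSn _); apply: leq_trans (leqnSn _).
  by rewrite -/(j (M k) k) -/(J k) mulnS addnC mulnC; apply: leq_trans (leq_addr _ _); apply: leq_pmulr.
- by rewrite leq_addl.
- rewrite wordsM => N dN; apply: (DP (M k, k)); apply: leq_ltn_trans dN.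
  by rewrite leq_addr.
Qed.

End SparseSequence.

(** Each large [N] lies in a window [d k < N <= d k.+1] with [a <= k]. The lower end gives
    [B ^ k <= N]; the upper end makes the alternating groups of level [k.+1] act trivially. *)
Theorem branch_group_slow (F : numClosedFieldType) : exists J : nat -> nat,
  forall a : nat, exists N0 : nat, forall N, (N0 <= N)%N -> exists B : nat, (B ^ a <= N)%N /\
    forall (I : finType) (d : I -> nat) (r : forall i, branch_group J -> 'M[F]_(d i)),
    (forall i, is_repr (r i)) -> (forall i, repr_irreducible (r i)) ->
    (forall i j, i != j -> disjoint_reprs (r i) (r j)) -> (forall i, d i <= N)%N ->
    (#|I| <= B)%N.
Proof.
have [J [d [Jd kd lb]]] := sparse_sequence; exists J => a.
exists (d a).+1 => N aN.
have ex : exists k, (a < k)%N && (N <= d k)%N.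
  exists (a + N).+1; rewrite ltnS leq_addr /=; apply: leq_trans (kd _).
  by rewrite leqW // leq_addl.
case: (ex_minnP ex) => -[//|k] /andP[ak Nk] kmin.
have dkN : (d k < N)%N.
  have [->//|ak'] := eqVneq k a.
  rewrite ltnNge; apply/negP => h; have := kmin k; rewrite h ltn_neqAle eq_sym ak' -ltnS ak.
  by move=> /(_ isT); rewrite ltnn.
have [s [u [hs u0 su hB]]] := lb k N dkN.
exists ((#|words k J|)`! * (8 * (u * u).+1 ^ (4 * u)) ^ #|words k J|)%N; split.
  apply: leq_trans hB; apply: leq_pexp2l => //.
  by rewrite muln_gt0 fact_gt0 expn_gt0 muln_gt0 expn_gt0.
move=> I e r rep irr dis eN; apply: (branch_irr_count hs u0 su _ rep irr dis eN).
by apply: leq_trans (Jd k.+1); rewrite leq_mul2l /= ltnS leq_exp2l.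
Qed.

Local Open Scope classical_set_scope.

(** * From disjoint families of representations to sets of isomorphism classes *)

Section Classes.
Variables (F : numClosedFieldType) (G : groupType).

Lemma iso_class_eq n (r s : G -> 'M[F]_n) T : T \in unitmx -> intertwines r s T ->
  repr_iso_class r = repr_iso_class s.
Proof.
move=> Tu Trs; apply/seteqP; split=> t [rt [P Pu hP]]; split=> //.
  exists (invmx T *m P); first by rewrite unitmx_mul unitmx_inv Tu.
  move=> g; rewrite -mulmxA -hP !mulmxA; congr (_ *m _).
  by rewrite -[s g](mulKmx Tu) -Trs !mulmxA mulmxK.
by exists (T *m P); [rewrite unitmx_mul Tu | move=> g; rewrite mulmxA Trs -!mulmxA hP].
Qed.

(** Classes of all degrees are counted together, hence the dependent pairs: equality of the degrees
    is itself a consequence of Schur's lemma. *)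
Lemma intertwiner_class n m (r : G -> 'M[F]_n) (s : G -> 'M[F]_m) T :
    repr_irreducible r -> repr_irreducible s -> intertwines r s T -> T != 0 ->
  existT (fun n => set (G -> 'M[F]_n)) n (repr_iso_class r) =
  existT (fun n => set (G -> 'M[F]_n)) m (repr_iso_class s).
Proof.
move=> ir is_ Trs T0; have [nm [fT _]] := schur_iso ir is_ Trs T0; subst m.
by rewrite (iso_class_eq _ Trs) // -row_free_unit.
Qed.

Variables (N B : nat).
Hypothesis bound : forall (I : finType) (d : I -> nat) (r : forall i, G -> 'M[F]_(d i)),
    (forall i, is_repr (r i)) -> (forall i, repr_irreducible (r i)) ->
    (forall i j, i != j -> disjoint_reprs (r i) (r j)) -> (forall i, d i <= N)%N ->
  (#|I| <= B)%N.

Lemma bound_classes (I : finType) (d : I -> nat) (c : forall i, set (G -> 'M[F]_(d i))) :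
    (forall i, irr_classes F G (d i) (c i)) -> (forall i, d i <= N)%N ->
    injective (fun i => existT (fun n => set (G -> 'M[F]_n)) (d i) (c i)) ->
  (#|I| <= B)%N.
Proof.
move=> hc dN inj.
have ex i : {r : G -> 'M[F]_(d i) | (is_repr r /\ repr_irreducible r) /\ repr_iso_class r = c i}.
  by apply: cid; have [r ? ?] := hc i; exists r.
apply: (bound (r := fun i => projT1 (ex i))) dN => [i|i|i j ij T Tint].
- by case: (ex i) => r [[]].
- by case: (ex i) => r [[]].
apply: contrapT => /eqP T0; case/eqP: ij; apply: inj; move: T Tint T0.
case: (ex i) => r [[hr ir] er]; case: (ex j) => s [[hs is_] es] /= T Tint T0.
rewrite -er -es; exact: intertwiner_class Tint T0.
Qed.

Lemma irr_classes_finite n : (n <= N)%N -> finite_set (irr_classes F G n).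
Proof.
move=> nN; apply: contrapT => /(infinite_set_fset B.+1)[X XA].
rewrite leqNgt ltnS => /negP; apply.
have <- : #|{: X}| = #|` X|%fset by rewrite cardfE.
apply: (@bound_classes X (fun _ => n) (fun x => val x)) => [x|//|x y e].
  by apply: XA; exact: (valP x).
by apply: val_inj; exact: (Eqdep_dec.inj_pair2_eq_dec _ PeanoNat.Nat.eq_dec _ _ _ _ e).
Qed.

Lemma sum_classes_bound :
  (\sum_(i < N) #|` fset_set (irr_classes F G i.+1)| <= B)%N.
Proof.
pose X (i : 'I_N) := fset_set (irr_classes F G i.+1).
have -> : (\sum_(i < N) #|` fset_set (irr_classes F G i.+1)|)%N = #|{: {i : 'I_N & X i}}|.
  rewrite card_tagged sumnE big_map big_enum /=.
  by apply: eq_bigr => i _; rewrite cardfE.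
apply: (@bound_classes {i : 'I_N & X i} (fun k => (tag k).+1) (fun k => val (tagged k))).
- move=> [i x] /=; have := valP x; rewrite in_fset_set; first by move/set_mem.
  by apply: irr_classes_finite.
- by move=> [i x] /=.
move=> [i x] [j y] /= e.
have ij : i = j by have /= [/val_inj] := congr1 (@projT1 _ _) e.
subst j; congr existT; apply: val_inj.
exact: (Eqdep_dec.inj_pair2_eq_dec _ PeanoNat.Nat.eq_dec _ _ _ _ e).
Qed.

End Classes.

(** * The upper limit in the extended reals *)

Section Growth.
Variables (R : realType) (G : groupType).
Local Open Scope ereal_scope.

Lemma num_irr_ge0 n : 0 <= num_irr R G n.
Proof. by rewrite /num_irr /counting; case: ifP => _; rewrite ?leey // lee_fin. Qed.

(** The trivial representation keeps the count at least 1, so the logarithm is nonnegative and the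
    growth is bounded below by 0. *)
Lemma num_irr1_ge1 : 1 <= num_irr R G 1.
Proof.
pose r : G -> 'M[R[i]]_1 := fun=> 1%:M.
have hr : irr_classes R[i] G 1 (repr_iso_class r).
  exists r => //; split; first by split=> // x y; rewrite mulmx1.
  split=> // U _ U0; rewrite /row_full eqn_leq rank_leq_row /=.
  by rewrite lt0n mxrank_eq0.
rewrite /num_irr /counting; case: ifP => [/asboolP fin|_]; last exact: leey.
rewrite lee_fin ler1n cardfs_gt0; apply/fset0Pn; exists (repr_iso_class r).
by rewrite in_fset_set // mem_set.
Qed.

Lemma num_irr_le_ge1 N : (0 < N)%N -> 1 <= num_irr_le R G N.
Proof.
move=> N0; rewrite /num_irr_le big_ltn //; apply: le_trans num_irr1_ge1 _.
by apply: leeDl; apply: sume_ge0 => i _; apply: num_irr_ge0.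
Qed.

Lemma num_irr_le_bound N B :
    (forall (I : finType) (d : I -> nat) (r : forall i, G -> 'M[R[i]]_(d i)),
      (forall i, is_repr (r i)) -> (forall i, repr_irreducible (r i)) ->
      (forall i j, i != j -> disjoint_reprs (r i) (r j)) -> (forall i, d i <= N)%N ->
      (#|I| <= B)%N) ->
  num_irr_le R G N <= (B%:R)%:E.
Proof.
move=> bound; rewrite /num_irr_le big_add1 big_mkord /=.
rewrite (eq_bigr (fun i : 'I_N => (#|` fset_set (irr_classes R[i] G i.+1)|%:R : R)%:E)).
  by rewrite sumEFin lee_fin -natr_sum ler_nat sum_classes_bound.
move=> i _; rewrite /num_irr /counting ifT //; apply/asboolP.
exact: (irr_classes_finite bound).
Qed.

(** From [B ^ a.+1 <= N] the quotient of logarithms is at most [1 / a.+1]; the quotients thus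
    converge to 0, and the upper limit is that limit. *)
Lemma slow_growth :
    (forall a : nat, exists N0 : nat, forall N, (N0 <= N)%N -> exists B : nat, (B ^ a <= N)%N /\
      forall (I : finType) (d : I -> nat) (r : forall i, G -> 'M[R[i]]_(d i)),
      (forall i, is_repr (r i)) -> (forall i, repr_irreducible (r i)) ->
      (forall i j, i != j -> disjoint_reprs (r i) (r j)) -> (forall i, d i <= N)%N ->
      (#|I| <= B)%N) ->
  repr_growth R G = 0.
Proof.
move=> slow; rewrite /repr_growth; set u := (fun n => _).
suff cv : u @ \oo --> 0 by have [_ ->] := cvg_limn_einf_sup cv.
have uP a : \forall N \near \oo, 0 <= u N <= ((a.+1%:R)^-1)%:E.
  have [N0 hN0] := slow a.+1.
  near=> N.
  have N2 : (1 < N)%N by near: N; exact: nbhs_infty_gt.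
  have NN0 : (N0 <= N)%N by near: N; exact: nbhs_infty_ge.
  have [B [BN /num_irr_le_bound numB]] := hN0 N NN0.
  have num1 := num_irr_le_ge1 (ltnW N2).
  have B1 : (1 <= B)%N by rewrite -(ler_nat R) -lee_fin; apply: le_trans numB.
  have lnN : (0 < ln (N%:R : R))%R by rewrite ln_gt0 // ltr1n.
  rewrite /u; apply/andP; split.
    by rewrite mule_ge0 ?lne_ge0 // lee_fin invr_ge0 ltW.
  have h : lne (num_irr_le R G N) <= (ln (N%:R : R) / a.+1%:R)%:E.
    apply: (@le_trans _ _ (lne (B%:R)%:E)).
      rewrite lee_lne // in_itv /= ?leey ?andbT ?lee_fin //.
      by apply: le_trans num1; rewrite lee_fin.
    rewrite lne_EFin ?ltr0n // lee_fin ler_pdivlMr ?ltr0n // mulr_natr -lnXn ?ltr0n //.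
    have Ba : (0 < B ^ a.+1)%N by rewrite expn_gt0 B1.
    by rewrite -natrX ler_ln ?posrE ?ltr0n ?ler_nat // ltnW.
  apply: le_trans (lee_wpmul2r _ h) _; first by rewrite lee_fin invr_ge0 ltW.
  by rewrite -EFinM lee_fin mulrAC divff ?gt_eqF // mul1r.
apply/fine_cvgP; split.
  near=> N; have /andP[h1 h2] : 0 <= u N <= ((1%:R)^-1)%:E by near: N; exact: (uP 0%N).
  by rewrite ge0_fin_numE // (le_lt_trans h2) // ltry.
apply/cvgrPdist_le => e e0.
have [a ha] : exists a : nat, (a.+1%:R^-1 <= e)%R.
  by have [a ha] := ltr_add_invr (y := 0) (x := e) e0; exists a; rewrite ltW // -[X in (X < _)%R]add0r.
near=> N; have /andP[h1 h2] : 0 <= u N <= ((a.+1%:R)^-1)%:E by near: N; exact: (uP a).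
have fu : u N \is a fin_num by rewrite ge0_fin_numE // (le_lt_trans h2) // ltry.
rewrite sub0r normrN /= ger0_norm ?fine_ge0 //.
by apply: le_trans ha; rewrite -lee_fin fineK.
Unshelve. all: by end_near.
Qed.

End Growth.

Local Close Scope classical_set_scope.
Local Close Scope ring_scope.

Theorem theorem9p2 (R : realType) :
  exists G : groupType,
    [/\ finitely_generated G,
        residually_finite G,
        infinite_set [set: G]%classic
      & repr_growth R G = 0%E].
Proof.
have [J slow] := branch_group_slow (R[i] : numClosedFieldType).
exists (branch_group J); split.
- exact: branch_finitely_generated.
- exact: branch_residually_finite.
- exact: branch_infinite.
- exact: slow_growth slow.
Qed.
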